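(* Let $(\Xi,m)$ be an abelian phase space with integrable irreducible projective representation $(U_x)_{x\in\Xi}$ on $\mathcal H$, let $S\subset\mathcal T^1(\mathcal H)$ be a regular subset and $H\subset\mathcal T^1(\mathcal H)$ relatively compact. If $X\subset\mathcal L(\mathcal H)$ is a bounded subset such that for each $A_0\in S$ $$\sup_{B\in X}|A_0\ast B(x)|\overset{x\to\infty}{\longrightarrow}0,$$ then also $$\sup_{A\in H}\sup_{B\in X}|A\ast B(x)|\overset{x\to\infty}{\longrightarrow}0.$$
   Context: Phase space: $\Xi$ is a locally compact abelian group (additive, fixed Haar measure), $m:\Xi\times\Xi\to\mathbb T$ is separately continuous with $m(x+y,z)m(x,y)=m(x,y+z)m(y,z)$ and $m(x,y)=m(-x,-y)$, and, with $\sigma(x,y)=m(x,y)/m(y,x)$, the map $x\mapsto\sigma(x,\cdot)$ is a topological isomorphism $\Xi\to\widehat\Xi$. $(U_x)_{x\in\Xi}$ is the (unique up to unitary equivalence) irreducible strongly continuous unitary projective representation on a Hilbert space $\mathcal H$ with $U_xU_y=m(x,y)U_{x+y}$, and $R$ is a self-adjoint unitary on $\mathcal H$ (unique up to sign) with $RU_x=U_{-x}R$. Integrable means: there is $0\ne\varphi\in\mathcal H$ with $x\mapsto\langle U_x\varphi,\varphi\rangle\in L^1(\Xi)$. $\mathcal T^1(\mathcal H)$ denotes the trace class operators with trace norm. For operators $\alpha_x(A)=U_xAU_x^\ast$, $\beta_-(A)=RAR$. For $A\in\mathcal T^1(\mathcal H)$, $B\in\mathcal L(\mathcal H)$, $A\ast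 B$ is the function $A\ast B(x)=\operatorname{Tr}(A\,\alpha_x(\beta_-(B)))$ on $\Xi$. $S\subset\mathcal T^1(\mathcal H)$ is regular if $\operatorname{span}\{\alpha_x(A):A\in S,x\in\Xi\}$ is dense in $\mathcal T^1(\mathcal H)$ (equivalently, the functions $\xi\mapsto\operatorname{Tr}(AU_\xi)$, $A\in S$, have no common zero). $F(x)\to0$ as $x\to\infty$ means: for every $\varepsilon>0$ there is a compact $K\subset\Xi$ with $|F(x)|<\varepsilon$ for all $x\in\Xi\setminus K$. *)

(* Defs.v *)
From HB Require Import structures.
From mathcomp Require Import all_boot all_order all_algebra finmap.
From mathcomp Require Import all_classical all_reals all_analysis.
From mathcomp Require Import complex sesquilinear.
From mathcomp.analysis.showcase Require summability.

Set Implicit Arguments.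
Unset Strict Implicit.
Unset Printing Implicit Defensive.

Import Order.TTheory GRing.Theory Num.Theory.
Import numFieldNormedType.Exports.

Local Open Scope classical_set_scope.
Local Open Scope ring_scope.

(* Going through [numClosedFieldType] gives the complex numbers the topology of
   their norm, for which [R[i]] itself carries no canonical instance. *)
Definition Cx (R : realType) : numClosedFieldType := R[i].

Definition modulus (R : realType) (z : Cx R) : R := complex.Re `|z|.

(* Completeness is part of [completeNormedModType]. The form [ip] is linear in
   its first argument and conjugate-linear in the second. *)
Definition hilbert_form (R : realType) (Hs : completeNormedModType (Cx R))
    (ip : {dot Hs for Num.conj}) : Prop :=
  forall v : Hs, `|v| ^+ 2 = ip v v.

Definition bounded_op (R : realType) (Hs : completeNormedModType (Cx R))
    (A : Hs -> Hs) : Prop :=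
  linear A /\ exists M : Cx R, forall v, `|A v| <= M * `|v|.

Definition bounded_subset (R : realType) (Hs : completeNormedModType (Cx R))
    (X : set (Hs -> Hs)) : Prop :=
  X `<=` @bounded_op R Hs /\
  exists M : Cx R, forall B v, X B -> `|B v| <= M * `|v|.

Definition adjoint (R : realType) (Hs : completeNormedModType (Cx R))
    (ip : {dot Hs for Num.conj}) (A : Hs -> Hs) : Hs -> Hs :=
  xget (fun=> 0)
    [set B | bounded_op B /\ forall u v, ip (A u) v = ip u (B v)].

Definition positive_op (R : realType) (Hs : completeNormedModType (Cx R))
    (ip : {dot Hs for Num.conj}) (P : Hs -> Hs) : Prop :=
  bounded_op P /\ forall v, 0 <= ip (P v) v.

Definition abs_op (R : realType) (Hs : completeNormedModType (Cx R))
    (ip : {dot Hs for Num.conj}) (A : Hs -> Hs) : Hs -> Hs :=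
  xget (fun=> 0) [set P | positive_op ip P /\ P \o P = adjoint ip A \o A].

(* A maximal orthonormal set. *)
Definition orthonormal_basis (R : realType)
    (Hs : completeNormedModType (Cx R)) (ip : {dot Hs for Num.conj})
    (E : set Hs) : Prop :=
  (forall e f, E e -> E f -> ip e f = (e == f)%:R) /\
  (forall v, (forall e, E e -> ip v e = 0) -> v = 0).

(* The trace and the trace norm do not depend on the orthonormal basis, so we
   compute them in an arbitrarily chosen one; it need not be countable. *)
Definition onb (R : realType) (Hs : completeNormedModType (Cx R))
    (ip : {dot Hs for Num.conj}) : set Hs :=
  xget set0 [set E | orthonormal_basis ip E].

Definition trace_norm (R : realType) (Hs : completeNormedModType (Cx R))
    (ip : {dot Hs for Num.conj}) (A : Hs -> Hs) : \bar R :=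
  \esum_(e in onb ip) (complex.Re (ip (abs_op ip A e) e))%:E.

Definition trace_class (R : realType) (Hs : completeNormedModType (Cx R))
    (ip : {dot Hs for Num.conj}) (A : Hs -> Hs) : Prop :=
  bounded_op A /\ (trace_norm ip A < +oo)%E.

(* Unconditional sum: the limit along finite subfamilies of [onb ip]. *)
Definition trace (R : realType) (Hs : completeNormedModType (Cx R))
    (ip : {dot Hs for Num.conj}) (A : Hs -> Hs) : Cx R :=
  summability.sum (fun e : Hs => if e \in onb ip then ip (A e) e else 0).

Record trace_class_op (R : realType) (Hs : completeNormedModType (Cx R))
    (ip : {dot Hs for Num.conj}) := TraceClassOp {
  tc_op :> Hs -> Hs;
  tc_opP : trace_class ip tc_op
}.

HB.instance Definition _ (R : realType) (Hs : completeNormedModType (Cx R))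
  (ip : {dot Hs for Num.conj}) := gen_eqMixin (trace_class_op ip).
HB.instance Definition _ (R : realType) (Hs : completeNormedModType (Cx R))
  (ip : {dot Hs for Num.conj}) := gen_choiceMixin (trace_class_op ip).

Definition trace_norm_ball (R : realType) (Hs : completeNormedModType (Cx R))
    (ip : {dot Hs for Num.conj}) (A : trace_class_op ip) (eps : R) :
    set (trace_class_op ip) :=
  [set B : trace_class_op ip |
    (trace_norm ip (fun v : Hs => (A v - B v)%R) < eps%:E)%E].

(* The metric topology of the trace norm, generated by the open balls. *)
HB.instance Definition _ (R : realType) (Hs : completeNormedModType (Cx R))
    (ip : {dot Hs for Num.conj}) :=
  isSubBaseTopological.Build (trace_class_op ip)
    [set O | exists (A : trace_class_op ip) (eps : R),
       0 < eps /\ O = trace_norm_ball A eps] id.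

Definition unitary_op (R : realType) (Hs : completeNormedModType (Cx R))
    (ip : {dot Hs for Num.conj}) (A : Hs -> Hs) : Prop :=
  [/\ bounded_op A, A \o adjoint ip A = id & adjoint ip A \o A = id].

Definition pointed_at0 (Xi : topologicalZmodType) : Type := Xi.
HB.instance Definition _ (Xi : topologicalZmodType) :=
  Choice.on (pointed_at0 Xi).
HB.instance Definition _ (Xi : topologicalZmodType) :=
  isPointed.Build (pointed_at0 Xi) (0 : Xi).

Notation borel Xi :=
  (g_sigma_algebraType (@open Xi : set (set (pointed_at0 Xi)))).

(* A translation-invariant Radon measure, nonzero on nonempty open sets. *)
Definition haar_measure (R : realType) (Xi : topologicalZmodType)
    (mu : {measure set (borel Xi) -> \bar R}) : Prop :=
  [/\ forall (x : Xi) (A : set (borel Xi)), measurable A ->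
        mu [set x + y | y in (A : set Xi)] = mu A,
      forall K : set Xi, compact K -> (mu K < +oo)%E,
      forall O : set Xi, open O -> O !=set0 -> (0 < mu O)%E,
      forall A : set (borel Xi), measurable A ->
        mu A = ereal_inf [set mu O | O in [set O : set Xi |
                                            open O /\ A `<=` O]]
    & forall O : set Xi, open O ->
        mu O = ereal_sup [set mu K | K in [set K : set Xi |
                                            compact K /\ K `<=` O]]].

Definition lc_abelian_group (Xi : topologicalZmodType) : Prop :=
  hausdorff_space Xi /\ locally_compact [set: Xi].

(* Carries the compact-open topology, as a subspace. *)
Definition dual_group (R : realType) (Xi : topologicalZmodType) :=
  set_type [set chi : {compact-open, Xi -> Cx R} |
    [/\ continuous (chi : Xi -> Cx R),
        forall x, `|chi x : Cx R| = 1
      & forall x y : Xi, chi (x + y) = chi x * chi y]].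

Definition symplectic (R : realType) (Xi : topologicalZmodType)
    (m : Xi -> Xi -> Cx R) (x y : Xi) : Cx R :=
  m x y / m y x.

Definition phase_space (R : realType) (Xi : topologicalZmodType)
    (m : Xi -> Xi -> Cx R) : Prop :=
  [/\ forall x y, `|m x y| = 1,
      (forall x, continuous (m x)) /\ (forall y, continuous (m^~ y)),
      forall x y z, m (x + y) z * m x y = m x (y + z) * m y z,
      forall x y, m x y = m (- x) (- y)
    & exists (f : Xi -> dual_group R Xi) (g : dual_group R Xi -> Xi),
        [/\ forall x, set_val (f x) = symplectic m x,
            forall x y z, symplectic m (x + y) z =
                          symplectic m x z * symplectic m y z,
            cancel f g /\ cancel g f,
            continuous f
          & continuous g]].

Definition projective_rep (R : realType) (Xi : topologicalZmodType)
    (m : Xi -> Xi -> Cx R) (Hs : completeNormedModType (Cx R))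
    (ip : {dot Hs for Num.conj}) (U : Xi -> Hs -> Hs) : Prop :=
  [/\ forall x, unitary_op ip (U x),
      forall x y v, U x (U y v) = m x y *: U (x + y) v
    & forall v, continuous (fun x => U x v)].

Definition irreducible_rep (R : realType) (Xi : topologicalZmodType)
    (Hs : completeNormedModType (Cx R)) (U : Xi -> Hs -> Hs) : Prop :=
  (exists v : Hs, v != 0) /\
  forall W : set Hs,
    W 0 -> (forall (a : Cx R) u v, W u -> W v -> W (a *: u + v)) ->
    closed W -> (forall x v, W v -> W (U x v)) ->
    W = [set 0] \/ W = setT.

Definition integrable_rep (R : realType) (Xi : topologicalZmodType)
    (mu : {measure set (borel Xi) -> \bar R})
    (Hs : completeNormedModType (Cx R)) (ip : {dot Hs for Num.conj})
    (U : Xi -> Hs -> Hs) : Prop :=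
  exists phi : Hs, [/\ phi != 0,
    mu.-integrable setT (fun x => (complex.Re (ip (U x phi) phi))%:E)
  & mu.-integrable setT (fun x => (complex.Im (ip (U x phi) phi))%:E)].

Definition parity_op (R : realType) (Xi : topologicalZmodType)
    (Hs : completeNormedModType (Cx R)) (ip : {dot Hs for Num.conj})
    (U : Xi -> Hs -> Hs) (P : Hs -> Hs) : Prop :=
  [/\ unitary_op ip P, adjoint ip P = P & forall x, P \o U x = U (- x) \o P].

Definition alpha (R : realType) (Xi : topologicalZmodType)
    (Hs : completeNormedModType (Cx R)) (ip : {dot Hs for Num.conj})
    (U : Xi -> Hs -> Hs) (x : Xi) (A : Hs -> Hs) : Hs -> Hs :=
  U x \o A \o adjoint ip (U x).

Definition beta_minus (R : realType) (Hs : completeNormedModType (Cx R))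
    (P A : Hs -> Hs) : Hs -> Hs :=
  P \o A \o P.

Definition op_conv (R : realType) (Xi : topologicalZmodType)
    (Hs : completeNormedModType (Cx R)) (ip : {dot Hs for Num.conj})
    (U : Xi -> Hs -> Hs) (P A B : Hs -> Hs) (x : Xi) : Cx R :=
  trace ip (A \o alpha ip U x (beta_minus P B)).

Definition translate_span (R : realType) (Xi : topologicalZmodType)
    (Hs : completeNormedModType (Cx R)) (ip : {dot Hs for Num.conj})
    (U : Xi -> Hs -> Hs) (S : set (trace_class_op ip)) :
    set (trace_class_op ip) :=
  [set T | exists (n : nat) (c : 'I_n -> Cx R) (A : 'I_n -> trace_class_op ip)
      (x : 'I_n -> Xi),
    (forall i, S (A i)) /\
    forall v, T v = \sum_(i < n) c i *: alpha ip U (x i) (A i) v].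

Definition regular (R : realType) (Xi : topologicalZmodType)
    (Hs : completeNormedModType (Cx R)) (ip : {dot Hs for Num.conj})
    (U : Xi -> Hs -> Hs) (S : set (trace_class_op ip)) : Prop :=
  dense (translate_span U S).

(* Supremum in [0, +oo], so that the supremum of the empty set is 0. *)
Definition nnsup (R : realType) (Y : set (\bar R)) : \bar R :=
  ereal_sup (0%E |` Y).

Definition vanishes_at_infinity (R : realType) (Xi : topologicalZmodType)
    (F : Xi -> \bar R) : Prop :=
  forall eps : R, 0 < eps ->
    exists2 K : set Xi, compact K & forall x, ~ K x -> (`|F x| < eps%:E)%E.

(* Main.v *)
(* Write |A| for the absolute value of a trace class operator A and Q for the
   square root of |A|. The polar decomposition gives A = V Q Q with Q
   Hilbert-Schmidt, so cyclicity of the trace and the bound of |Tr(A K)| by a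
   constant, depending only on |K|, times the trace norm of A both reduce to
   Hilbert-Schmidt operators, where they follow from Parseval's identity and
   polarization. By cyclicity, convolving a translate of A0 with B amounts to
   translating A0 * B, so the elements of the span of the translates of S inherit
   the uniform decay. By the bound, A |-> A * B(x) is Lipschitz for the trace
   norm, uniformly in B and x; hence the decay extends to the closure of that span,
   which is everything, and is locally uniform in A, thus uniform on compact sets. *)
Require Import Defs.
From HB Require Import structures.
From mathcomp Require Import all_boot all_order all_algebra finmap.
From mathcomp Require Import all_classical all_reals all_analysis.
From mathcomp Require Import complex sesquilinear ring lra.
From mathcomp.analysis.showcase Require summability.

Set Implicit Arguments.
Unset Strict Implicit.
Unset Printing Implicit Defensive.

Import Order.TTheory GRing.Theory Num.Theory.
Import numFieldNormedType.Exports.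

Local Open Scope classical_set_scope.
Local Open Scope ring_scope.

(** [adjoint], [abs_op] and [trace] are choices or limits that fall back on a default value, so
    existence or convergence has to be established before any identity about them can be used. This
    shapes the proof. A single minimization over the range of an operator yields both the adjoint
    and the polar factor. The square root of a positive operator comes from an iteration dominated
    by a scalar one. For traces, polarization writes [ip (X e) (Y e)] through four nonnegative
    families with finite sums, so convergence and the value are obtained together; passing to
    adjoints preserves these four sums, and this is where cyclicity comes from. *)

(** * Real and complex scalars *)

Lemma quadratic_lin_eq (R : realType) (a b c : R) :
  0 <= c -> (forall t : R, 0 <= 2 * t * (a - b) + t ^+ 2 * c) -> a = b.
Proof.
move=> c0 h; apply/eqP; rewrite -subr_eq0; set d := a - b in h *.
have [c00|cn0] := eqVneq c 0.
  have := h (- d); rewrite c00 mulr0 addr0 => h1.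
  have : 0 <= d ^+ 2 by exact: sqr_ge0.
  rewrite -sqrf_eq0 => h2; apply/eqP; nra.
have cp : 0 < c by rewrite lt_def cn0.
(* The quadratic is smallest at [t = - (d / c)], with value [- (d ^+ 2 / c)]: the first variation at
   a minimum vanishes. *)
have := h (- (d / c)); rewrite sqrrN.
have -> : 2 * - (d / c) * d + (d / c) ^+ 2 * c = - (d ^+ 2 / c) by field.
rewrite oppr_ge0 pmulr_lle0 ?invr_gt0// => h1.
by rewrite -sqrf_eq0 eq_le h1 sqr_ge0.
Qed.

Lemma le_eps (R : realType) (a b c : R) : 0 <= c ->
  (forall eps, 0 < eps -> a <= b + eps * c) -> a <= b.
Proof.
move=> c0 h; apply/ler_addgt0Pr => e e0.
have c1 : 0 < c + 1 by rewrite ltr_wpDl.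
have := h (e / (c + 1)); rewrite divr_gt0// => /(_ isT) /le_trans; apply.
by rewrite lerD2l mulrAC ler_pdivrMr// ler_pM2l// lerDl ler01.
Qed.

Lemma natSinv_small (R : realType) (eps : R) : 0 < eps ->
  exists N, forall n, (N <= n)%N -> n.+1%:R^-1 < eps.
Proof.
move=> e0; have [N _ hN] := near_infty_natSinv_lt (PosNum e0).
by exists N => n Nn; exact: (hN n Nn).
Qed.

Lemma modulusE (R : realType) (z : Cx R) : `|z| = (modulus z)%:C%C.
Proof. by rewrite /modulus normc_def. Qed.

Lemma modulus_ge0 (R : realType) (z : Cx R) : 0 <= modulus z.
Proof. by rewrite -(@ler0c R) -modulusE. Qed.

Lemma modulusM (R : realType) (z w : Cx R) : modulus (z * w) = modulus z * modulus w.
Proof. by apply: (@complexI R); rewrite rmorphM /= -!modulusE normrM. Qed.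

Lemma modulusD (R : realType) (z w : Cx R) : modulus (z + w) <= modulus z + modulus w.
Proof. by rewrite -(@lecR R) rmorphD /= -!modulusE ler_normD. Qed.

Lemma ReD (R : realType) (z w : Cx R) :
  complex.Re (z + w) = complex.Re z + complex.Re w.
Proof. by case: z w => [? ?] [? ?]. Qed.

Lemma ReN (R : realType) (z : Cx R) : complex.Re (- z) = - complex.Re z.
Proof. by case: z => [? ?]. Qed.

(** * Real-valued calculus in a complex Hilbert space *)

Section InnerProduct.
Variables (R : realType) (Hs : completeNormedModType (Cx R)).
Variable ip : {dot Hs for Num.conj}.
Hypothesis hip : hilbert_form ip.

(* The norm of [Hs] is complex-valued; [nr] and [re] live in the ordered field [R]. *)
Definition nr (v : Hs) : R := complex.Re (`|v| : Cx R).
Definition re (u v : Hs) : R := complex.Re (ip u v).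

Definition rc (r : R) : Cx R := r%:C%C.
Definition ii : Cx R := 'i%C.

Lemma normE v : `|v| = rc (nr v).
Proof. by rewrite /nr /rc RRe_real // ger0_real. Qed.

Lemma nr_ge0 v : 0 <= nr v.
Proof. by rewrite -(@ler0c R) -[X in 0 <= X]/(rc _) -normE normr_ge0. Qed.

Lemma rcM a b : rc (a * b) = rc a * rc b. Proof. exact: rmorphM. Qed.
Lemma rcD a b : rc (a + b) = rc a + rc b. Proof. exact: rmorphD. Qed.
Lemma rcB a b : rc (a - b) = rc a - rc b. Proof. exact: rmorphB. Qed.
Lemma rcN a : rc (- a) = - rc a. Proof. exact: rmorphN. Qed.
Lemma rc0 : rc 0 = 0. Proof. by []. Qed.
Lemma Re_rcM a (z : Cx R) : complex.Re (rc a * z) = a * complex.Re z.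
Proof. by case: z => x y /=; rewrite mul0r subr0. Qed.

Lemma le_rc a b : (rc a <= rc b) = (a <= b).
Proof. exact: lecR. Qed.

Lemma lt_rc a b : (rc a < rc b) = (a < b).
Proof. exact: ltcR. Qed.

Lemma ip_vv v : ip v v = rc (nr v ^+ 2).
Proof. by rewrite -hip normE expr2 expr2 rcM. Qed.

Lemma re_vv v : re v v = nr v ^+ 2.
Proof. by rewrite /re ip_vv. Qed.

Lemma ipC u v : ip u v = (ip v u)^*.
Proof. by rewrite hermC expr0 mul1r. Qed.

Lemma conjE (z : Cx R) : z^* = (z^*)%C.
Proof. by []. Qed.

Lemma reC u v : re u v = re v u.
Proof. by rewrite /re ipC conjE; case: (ip v u). Qed.

Lemma reDl u v w : re (u + v) w = re u w + re v w.
Proof. by rewrite /re linearDl ReD. Qed.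

Lemma reNl u w : re (- u) w = - re u w.
Proof. by rewrite /re linearNl ReN. Qed.

Lemma reZl r u w : re (rc r *: u) w = r * re u w.
Proof. by rewrite /re linearZl_LR Re_rcM. Qed.

Lemma reDr u v w : re w (u + v) = re w u + re w v.
Proof. by rewrite reC reDl !(reC w). Qed.

Lemma reNr u w : re w (- u) = - re w u.
Proof. by rewrite reC reNl (reC w). Qed.

Lemma reZr r u w : re w (rc r *: u) = r * re w u.
Proof. by rewrite reC reZl (reC w). Qed.

Definition reE := (reDl, reDr, reNl, reNr, reZl, reZr).

Lemma Im_ip u v : complex.Im (ip u v) = re u (ii *: v).
Proof.
rewrite /re linearZr_LR /= conjE /ii; case: (ip u v) => x y /=.
by rewrite mul0r sub0r mulN1r opprK.
Qed.

Lemma ip_re u v : ip u v = rc (re u v) + ii * rc (re u (ii *: v)).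
Proof. by rewrite -Im_ip {1}[ip u v]complexE. Qed.

Lemma re_ii u v : re (ii *: u) (ii *: v) = re u v.
Proof.
rewrite /re linearZl_LR linearZr_LR /= conjE /ii; case: (ip u v) => x y /=.
by rewrite !mul0r !sub0r !mul1r add0r !mulN1r !opprK.
Qed.

Lemma nr0 : nr (0 : Hs) = 0.
Proof. by rewrite /nr normr0. Qed.

Lemma nr_eq0 v : nr v = 0 -> v = 0.
Proof. by move=> v0; apply/normr0_eq0; rewrite normE v0. Qed.

Lemma nrN v : nr (- v) = nr v.
Proof. by rewrite /nr normrN. Qed.

Lemma nrB u v : nr (u - v) = nr (v - u).
Proof. by rewrite -nrN opprB. Qed.

Lemma nrZ a v : nr (a *: v) = modulus a * nr v.
Proof. by rewrite /nr normrZ modulusE normE Re_rcM. Qed.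

Lemma nrD u v : nr (u + v) <= nr u + nr v.
Proof. by rewrite -le_rc rcD -!normE ler_normD. Qed.

Lemma nr_dist w u v : nr (u - v) <= nr (u - w) + nr (w - v).
Proof. by rewrite -[u - v](subrKA w) nrD. Qed.

Lemma nr_rc r v : nr (rc r *: v) = `|r| * nr v.
Proof.
by rewrite nrZ /modulus normc_def /rc /= expr0n addr0 sqrtr_sqr.
Qed.

Lemma nr_sqrD u v : nr (u + v) ^+ 2 = nr u ^+ 2 + 2 * re u v + nr v ^+ 2.
Proof. rewrite -!re_vv !reE (reC v); lra. Qed.

Lemma nr_sqrB u v : nr (u - v) ^+ 2 = nr u ^+ 2 - 2 * re u v + nr v ^+ 2.
Proof. by rewrite nr_sqrD reNr nrN; lra. Qed.

Lemma re_le u v : re u v <= nr u * nr v.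
Proof.
have [u0|u0] := eqVneq (nr u) 0.
  by rewrite u0 (nr_eq0 u0) mul0r /re linear0l.
have [v0|v0] := eqVneq (nr v) 0.
  by rewrite v0 (nr_eq0 v0) mulr0 reC /re linear0l.
(* Expanding this square gives Cauchy-Schwarz multiplied by [2 * (nr u * nr v)]. *)
have : 0 <= nr (rc (nr v) *: u - rc (nr u) *: v) ^+ 2 by exact: sqr_ge0.
rewrite nr_sqrB !reE !nr_rc !ger0_norm ?nr_ge0//.
have up : 0 < nr u by rewrite lt_def u0 nr_ge0.
have vp : 0 < nr v by rewrite lt_def v0 nr_ge0.
have p : 0 < nr u * nr v by rewrite mulr_gt0.
by move=> h; rewrite -(ler_pM2l p); lra.
Qed.

Lemma re_le_abs u v : `|re u v| <= nr u * nr v.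
Proof. by rewrite ler_norml re_le andbT -lerNl -reNl -(nrN u) re_le. Qed.

(** Real parts at [ii *: v] are the negated imaginary parts at [v], so complex identities can be
    checked on real parts. *)
Lemma ip_from_re (g : Hs -> Cx R) (h : Hs -> Cx R) :
  (forall a v, g (a *: v) = a * g v) -> (forall a v, h (a *: v) = a * h v) ->
  (forall v, complex.Re (g v) = complex.Re (h v)) -> g =1 h.
Proof.
move=> gZ hZ gh v; have e1 := gh v; have := gh (ii *: v).
rewrite gZ hZ /ii; move: e1; case: (g v) (h v) => a b [c d] /= ->.
by rewrite !mul0r !mul1r !sub0r => /oppr_inj ->.
Qed.

Lemma nr_complete (u : nat -> Hs) :
  (forall eps, 0 < eps -> exists N, forall n k, (N <= n)%N -> (N <= k)%N ->
     nr (u n - u k) < eps) ->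
  exists l, forall eps, 0 < eps -> exists N, forall n, (N <= n)%N ->
     nr (u n - l) < eps.
Proof.
move=> cu.
have : cvgn u.
  apply/cauchy_cvgP/cauchy_exP => e e0.
  have ie : e = rc (complex.Re e) by rewrite /rc RRe_real // gtr0_real.
  have [|N hN] := cu (complex.Re e); first by rewrite -lt_rc -ie.
  exists (u N), N => // n /= Nn.
  by rewrite -ball_normE /= ie normE lt_rc; apply: hN.
move=> /cvg_ex[l ul]; exists l => eps e0.
move/cvgrPdist_lt : ul => /(_ (rc eps)); rewrite lt_rc => /(_ e0)[N _ hN].
by exists N => n Nn; have := hN n Nn; rewrite normE lt_rc nrB.
Qed.

End InnerProduct.

Section Linear.
Variables (R : realType) (Hs : completeNormedModType (Cx R)) (A : Hs -> Hs).
Hypothesis lA : linear A.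

Lemma linop0 : A 0 = 0.
Proof. by have := lA (-1) 0 0; rewrite scaler0 addr0 scaleN1r addNr. Qed.

Lemma linopZ a v : A (a *: v) = a *: A v.
Proof. by have := lA a v 0; rewrite !addr0 linop0 addr0. Qed.

Lemma linopD u v : A (u + v) = A u + A v.
Proof. by have := lA 1 u v; rewrite !scale1r. Qed.

Lemma linopN v : A (- v) = - A v.
Proof. by rewrite -scaleN1r linopZ scaleN1r. Qed.

Lemma linopB u v : A (u - v) = A u - A v.
Proof. by rewrite linopD linopN. Qed.

End Linear.

(** * Riesz representation and factorization of operators *)

Section Riesz.
Variables (R : realType) (Hs : completeNormedModType (Cx R)).
Variable ip : {dot Hs for Num.conj}.
Hypothesis hip : hilbert_form ip.
Local Notation re := (@re R Hs ip).

(* [z] is the limit of [Pm v] along a minimising sequence of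
   [|Pm v|^2 - 2 Re (g v)]. *)
Lemma riesz_range (Pm : Hs -> Hs) (g : Hs -> Cx R) (K : R) :
  linear Pm -> (forall a u v, g (a *: u + v) = a * g u + g v) -> 0 <= K ->
  (forall v, complex.Re (g v) <= K * nr (Pm v)) ->
  exists z, [/\ forall v, g v = ip (Pm v) z,
    forall eps, 0 < eps -> exists v, nr (Pm v - z) < eps & nr z <= K].
Proof.
move=> lP lg K0 gK.
have gD u v : complex.Re (g (u + v)) = complex.Re (g u) + complex.Re (g v).
  by have := lg 1 u v; rewrite scale1r mul1r => ->; rewrite ReD.
have g0 : g 0 = 0.
  by have := lg (-1) 0 0; rewrite scaler0 addr0 mulN1r addNr.
have gZ a v : g (a *: v) = a * g v by have := lg a v 0; rewrite !addr0 g0 addr0.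
have grZ (a : R) v : complex.Re (g (rc a *: v)) = a * complex.Re (g v).
  by rewrite gZ Re_rcM.
pose J v : R := nr (Pm v) ^+ 2 - 2 * complex.Re (g v).
have Jlb v : - K ^+ 2 <= J v.
  rewrite /J; have := gK v; have : 0 <= (nr (Pm v) - K) ^+ 2 by exact: sqr_ge0.
  nra.
have hJ : has_inf (range J).
  by split; [exists (J 0), 0 | exists (- K ^+ 2) => _ [v _ <-]].
have Jd v : inf (range J) <= J v by apply: ge_inf; [exact: hJ.2 | exists v].
have /choice[u hu] : forall n, exists v, J v < inf (range J) + n.+1%:R^-1.
  move=> n; have [] := @inf_adherent _ (range J) n.+1%:R^-1 _ hJ.
    by rewrite invr_gt0 ltr0n.
  by move=> _ [v _ <-] h; exists v.
set d := inf (range J) in Jd hu *.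
move: d Jd hu => d Jd hu {hJ}.
have Jpar v w t : J (v + rc t *: w) =
    J v + 2 * t * (re (Pm v) (Pm w) - complex.Re (g w)) + t ^+ 2 * nr (Pm w) ^+ 2.
  rewrite /J linopD// linopZ// (nr_sqrD hip) nr_rc exprMn real_normK ?num_real//.
  rewrite gD grZ !reE//; lra.
(* Parallelogram law, with [J] at the midpoint of [v] and [w] bounded below by [d]; it makes a
   minimizing sequence Cauchy. *)
have dist v w : nr (Pm v - Pm w) ^+ 2 <= 2 * (J v - d) + 2 * (J w - d).
  have := Jd (rc 2^-1 *: (v + w)); rewrite /J grZ gD linopZ// nr_rc exprMn.
  rewrite real_normK ?num_real// linopD// (nr_sqrB hip) (nr_sqrD hip); lra.
have [z hz] : exists l, forall eps, 0 < eps -> exists N, forall n, (N <= n)%N ->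
     nr (Pm (u n) - l) < eps.
  apply: nr_complete => // eps e0.
  have [|N hN] := natSinv_small (eps := eps ^+ 2 / 4).
    by rewrite divr_gt0// exprn_gt0.
  exists N => n k Nn Nk.
  rewrite -(@ltr_pXn2r _ 2)// ?nnegrE ?nr_ge0 ?ltW//.
  apply: (le_lt_trans (dist _ _)).
  have := hN n Nn; have := hN k Nk; have := hu n; have := hu k.
  move: (J (u n)) (J (u k)) (n.+1%:R^-1) (k.+1%:R^-1) => *; lra.
have zP w : complex.Re (g w) = re (Pm w) z.
  rewrite reC; symmetry.
  apply: (@quadratic_lin_eq _ _ _ (nr (Pm w) ^+ 2)); first exact: sqr_ge0.
  (* Vanishing first variation along [w]: the error 1 is the excess of [J (u n)] over [d], the rest
     is the cost of replacing [Pm (u n)] by [z]. *)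
  move=> t; apply: (@le_eps _ _ _ (1 + 2 * `|t| * nr (Pm w))).
    by rewrite addr_ge0// !mulr_ge0// nr_ge0.
  move=> eps e0.
  have [N1 h1] := hz eps e0; have [N2 h2] := natSinv_small e0.
  pose n := maxn N1 N2.
  have := h1 n (leq_maxl _ _); have := h2 n (leq_maxr _ _).
  have := hu n; have := Jd (u n + rc t *: w); rewrite Jpar => a1 a2 a3 a4.
  have a5 : t * re (Pm (u n)) (Pm w) <= t * re z (Pm w) + `|t| * (eps * nr (Pm w)).
    rewrite -lerBlDl -mulrBr; apply: (le_trans (ler_norm _)).
    rewrite normrM ler_wpM2l//.
    have -> : re (Pm (u n)) (Pm w) - re z (Pm w) = re (Pm (u n) - z) (Pm w).
      by rewrite !reE.
    by apply: (le_trans (re_le_abs hip _ _)); rewrite ler_wpM2r ?nr_ge0// ltW.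
  move: (n.+1%:R^-1) (J (u n)) (re (Pm (u n)) (Pm w)) (re z (Pm w))
    (complex.Re (g w)) (nr (Pm w)) a1 a2 a3 a5 => *; lra.
have zcl eps : 0 < eps -> exists v, nr (Pm v - z) < eps.
  by move=> /hz[N hN]; exists (u N); apply: hN.
exists z; split=> //.
  apply: ip_from_re => //.
  - by move=> a v; rewrite linopZ// linearZl_LR.
(* Norm bound: [re z z] is close to [re (Pm v) z], the real part of [g v], which is at most
   [K * nr (Pm v)], and [Pm v] is close to [z]. *)
have [->|zn0] := eqVneq (nr z) 0; first by [].
have zp : 0 < nr z by rewrite lt_def zn0 nr_ge0.
rewrite -(ler_pM2r zp) -expr2 -(re_vv hip).
apply: (@le_eps _ _ _ (nr z + K)); first by rewrite addr_ge0// nr_ge0.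
move=> eps /zcl[v hv].
have -> : re z z = re (z - Pm v) z + re (Pm v) z by rewrite -reDl subrK.
have b1 : re (z - Pm v) z <= eps * nr z.
  by apply: (le_trans (re_le hip _ _)); rewrite ler_wpM2r ?nr_ge0// nrB ltW.
have b2 : re (Pm v) z <= K * (eps + nr z).
  rewrite -zP; apply: (le_trans (gK v)); rewrite ler_wpM2l//.
  by rewrite -[Pm v](subrK z); apply: (le_trans (nrD _ _)); rewrite lerD2r ltW.
lra.
Qed.

Lemma closure_orth_eq0 (Pm : Hs -> Hs) d :
  (forall v, ip (Pm v) d = 0) ->
  (forall eps, 0 < eps -> exists v, nr (Pm v - d) < eps) -> d = 0.
Proof.
move=> orth cl; apply: nr_eq0.
suff : nr d ^+ 2 <= 0 by move=> h; apply/eqP; rewrite -sqrf_eq0 eq_le h sqr_ge0.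
apply: (@le_eps _ _ _ (nr d)); first exact: nr_ge0.
move=> eps /cl[v hv]; rewrite add0r -(re_vv hip).
have -> : re d d = re (d - Pm v) d.
  by rewrite reDl reNl [X in _ - X](_ : _ = 0) ?subr0// /re orth.
by apply: (le_trans (re_le hip _ _)); rewrite ler_wpM2r ?nr_ge0// nrB ltW.
Qed.

(* Douglas factorization [A^* = Pm^* W]. For [Pm = id] this is the adjoint, for
   [Pm = |A|] the polar decomposition. *)
Lemma douglas (A Pm : Hs -> Hs) (K : R) :
  linear A -> linear Pm -> 0 <= K -> (forall v, nr (A v) <= K * nr (Pm v)) ->
  exists W : Hs -> Hs, [/\ linear W, forall u, nr (W u) <= K * nr u
    & forall v u, ip (A v) u = ip (Pm v) (W u)].
Proof.
move=> lA lP K0 AP.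
have /choice[W hW] : forall u, exists z, [/\ forall v, ip (A v) u = ip (Pm v) z,
    forall eps, 0 < eps -> exists v, nr (Pm v - z) < eps & nr z <= K * nr u].
  move=> u; apply: (@riesz_range Pm (fun v => ip (A v) u)) => //.
  - by move=> a v w; rewrite lA linearPl.
  - by rewrite mulr_ge0// nr_ge0.
  - move=> v; apply: (le_trans (re_le hip _ _)).
    by rewrite mulrAC ler_wpM2r ?nr_ge0.
exists W; split; [|by move=> u; case: (hW u)|by move=> v u; case: (hW u)].
(* The representing vectors lie in the closure of the range of [Pm], where they are unique; the
   defect of linearity is both in this closure and orthogonal to the range. *)
move=> a u v; apply/eqP; rewrite -subr_eq0; apply/eqP.
apply: (@closure_orth_eq0 Pm) => [w|eps e0].
  rewrite linearBr linearDr linearZr_LR /=.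
  have [<- _ _] := hW u; have [<- _ _] := hW v; have [<- _ _] := hW (a *: u + v).
  by rewrite linearDr linearZr_LR /= subrr.
have e3 : 0 < eps / 3 by rewrite divr_gt0.
have ma : 0 < 1 + modulus a by rewrite ltr_pwDl// modulus_ge0.
have ea : 0 < eps / 3 / (1 + modulus a) by rewrite divr_gt0.
have [_ /(_ _ ea)[u' hu] _] := hW u; have [_ /(_ _ e3)[v' hv] _] := hW v.
have [_ /(_ _ e3)[w' hw] _] := hW (a *: u + v).
exists (w' - (a *: u' + v')); rewrite linopB// linopD// linopZ//.
have -> : Pm w' - (a *: Pm u' + Pm v') - (W (a *: u + v) - (a *: W u + W v)) =
  (Pm w' - W (a *: u + v)) + (- (a *: (Pm u' - W u)) + - (Pm v' - W v)).
  by rewrite scalerBr !opprB opprD (AC ((1*2)*(2*1)) ((1*6)*((4*2)*(5*3)))).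
apply: (le_lt_trans (nrD _ _)); apply: (le_lt_trans (lerD (lexx _) (nrD _ _))).
rewrite !nrN nrZ.
have : modulus a * nr (Pm u' - W u) <= eps / 3.
  apply: (@le_trans _ _ ((1 + modulus a) * nr (Pm u' - W u))).
    by rewrite ler_wpM2r ?nr_ge0// lerDr ler01.
  by rewrite mulrC -ler_pdivlMr// ltW.
lra.
Qed.

End Riesz.

(** * Bounded, adjoint and positive operators *)

Section Operators.
Variables (R : realType) (Hs : completeNormedModType (Cx R)).
Variable ip : {dot Hs for Num.conj}.
Hypothesis hip : hilbert_form ip.
Local Notation re := (@re R Hs ip).

(** A nonzero [v] forces [M] to be real and nonnegative in the complex order; [modulus M] also
    covers the zero space, where [M] is arbitrary. *)
Lemma bounded_bound (B : Hs -> Hs) (M : Cx R) :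
  (forall v, `|B v| <= M * `|v|) -> forall v, nr (B v) <= modulus M * nr v.
Proof.
move=> h v; have := h v; have [->|v0] := eqVneq v 0.
  by rewrite normr0 mulr0 nr0 mulr0 normr_le0 => /eqP ->; rewrite nr0.
have vp : 0 < `|v| by rewrite normr_gt0.
move=> hv; have M0 : 0 <= M.
  by rewrite -(pmulr_lge0 _ vp); apply: le_trans hv.
by rewrite -le_rc rcM -!normE -[rc (modulus M)]modulusE ger0_norm.
Qed.

Lemma bounded_opP (A : Hs -> Hs) : bounded_op A <->
  linear A /\ exists2 K : R, 0 <= K & forall v, nr (A v) <= K * nr v.
Proof.
split=> -[lA]; last first.
  move=> [K K0 h]; split=> //; exists (rc K) => v.
  by rewrite !normE -rcM le_rc.
move=> [M h]; split=> //; exists (modulus M); first exact: modulus_ge0.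
exact: bounded_bound.
Qed.

Lemma bounded_id : bounded_op (id : Hs -> Hs).
Proof. by apply/bounded_opP; split=> //; exists 1 => // v; rewrite mul1r. Qed.

Lemma bounded_comp (A B : Hs -> Hs) :
  bounded_op A -> bounded_op B -> bounded_op (A \o B).
Proof.
move=> /bounded_opP[lA [K K0 hA]] /bounded_opP[lB [L L0 hB]].
apply/bounded_opP; split; first by move=> a u v /=; rewrite lB lA.
exists (K * L) => [|v /=]; first exact: mulr_ge0.
by apply: (le_trans (hA _)); rewrite -mulrA ler_wpM2l.
Qed.

Lemma adjoint_spec (A : Hs -> Hs) : bounded_op A ->
  bounded_op (adjoint ip A) /\ forall u v, ip (A u) v = ip u (adjoint ip A v).
Proof.
move=> /bounded_opP[lA [K K0 hA]].
have lid : linear (id : Hs -> Hs) by [].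
have [W [lW hW AW]] := douglas hip lA lid K0 hA.
rewrite /adjoint; case: xgetP => [B _ //|/(_ W) h].
by case: h; split=> //; apply/bounded_opP; split=> //; exists K.
Qed.

(** A relation, so that adjoints of composites can be written down directly instead of being
    identified with the operator chosen by [adjoint]. *)
Definition adjoint_pair (A B : Hs -> Hs) := forall u v, ip (A u) v = ip u (B v).

Lemma adjoint_pairC (A B : Hs -> Hs) : adjoint_pair A B -> adjoint_pair B A.
Proof. by move=> AB u v; rewrite ipC -AB -ipC. Qed.

Lemma adjoint_pair_re (A B : Hs -> Hs) : adjoint_pair A B ->
  forall u v, re (A u) v = re u (B v).
Proof. by move=> AB u v; rewrite /re AB. Qed.

Lemma adjoint_pair_bound (A B : Hs -> Hs) (K : R) : adjoint_pair A B ->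
  (forall v, nr (A v) <= K * nr v) -> forall v, nr (B v) <= K * nr v.
Proof.
move=> AB hA v; have [->|n0] := eqVneq (nr (B v)) 0.
  by apply: le_trans (hA v); exact: nr_ge0.
have np : 0 < nr (B v) by rewrite lt_def n0 nr_ge0.
rewrite -(ler_pM2l np) -expr2 -(re_vv hip) -(adjoint_pair_re AB).
apply: (le_trans (re_le hip _ _)).
by rewrite [leRHS]mulrA (mulrC _ K) ler_wpM2r// nr_ge0.
Qed.

Lemma symmetric_from_re (T : Hs -> Hs) : linear T ->
  (forall u v, re (T u) v = re u (T v)) -> adjoint_pair T T.
Proof.
move=> lT sT u v.
apply: (@ip_from_re R Hs (fun u => ip (T u) v) (fun u => ip u (T v))) => //.
- by move=> a w; rewrite linopZ// linearZl_LR.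
- by move=> a w; rewrite linearZl_LR.
- by move=> w; exact: sT.
Qed.

(** Positivity makes [ip (T w) w] real, that is, [re (T w) (ii *: w) = 0]; polarizing this at
    [ii *: u + v] gives symmetry. *)
Lemma positive_symmetric (T : Hs -> Hs) : positive_op ip T -> adjoint_pair T T.
Proof.
move=> [[lT _] pT]; apply: symmetric_from_re => // u v.
have h w : re (T w) (ii R *: w) = 0.
  by rewrite -Im_ip; apply: ger0_Im; exact: pT.
have := h (ii R *: u + v); rewrite linopD// scalerDr !reE !h add0r addr0.
rewrite linopZ// re_ii scalerA.
have -> : ii R * ii R = -1 by rewrite -expr2 /ii sqr_i.
by rewrite scaleN1r reNr (reC _ u) => /eqP; rewrite subr_eq0 => /eqP.
Qed.

Lemma positive_re (T : Hs -> Hs) v : positive_op ip T -> 0 <= re (T v) v.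
Proof. by move=> [_ /(_ v)]; rewrite lecE => /andP[]. Qed.

(** * Square roots of positive operators *)

Section SquareRoot.
Variable S : Hs -> Hs.
Hypotheses (lS : linear S) (sS : forall u v, re (S u) v = re u (S v)).
Hypothesis cS : forall v, nr (S v) <= nr v.

(* The iterates of [Y |-> (S + Y^2) / 2] form a Cauchy sequence because their
   increments are dominated by those of the scalar iterates [sqy] of
   [y |-> (1 + y^2) / 2]; the limit solves [Y^2 = 2 Y - S]. *)
Fixpoint sqY (n : nat) (v : Hs) : Hs :=
  if n is n'.+1 then rc 2^-1 *: (S v + sqY n' (sqY n' v)) else 0.

Fixpoint sqy (n : nat) : R := if n is n'.+1 then (1 + sqy n' ^+ 2) / 2 else 0.

Lemma sqy_itv n : 0 <= sqy n <= 1.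
Proof. by elim: n => [|n /andP[? ?]] /=; [rewrite lexx ler01 | nra]. Qed.

Lemma sqY_linear n : linear (sqY n).
Proof.
elim: n => [|n ih] a u v /=; first by rewrite scaler0 addr0.
by rewrite lS !ih addrACA !scalerDr !scalerA !(mulrC a).
Qed.

Lemma sqY_sym n u v : re (sqY n u) v = re u (sqY n v).
Proof.
elim: n u v => [|n ih] u v /=; first by rewrite /re linear0l linear0r.
by rewrite !reE sS !ih.
Qed.

Lemma sqY_le n v : nr (sqY n v) <= sqy n * nr v.
Proof.
elim: n v => [|n ih] v /=; first by rewrite nr0 mul0r.
rewrite nr_rc ger0_norm ?invr_ge0//.
have /andP[y0 _] := sqy_itv n.
have : sqy n * nr (sqY n v) <= sqy n * (sqy n * nr v) by rewrite ler_wpM2l.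
have := ih (sqY n v); have := cS v; have := nrD (S v) (sqY n (sqY n v)); nra.
Qed.

Lemma sqY_step n v : nr (sqY n.+1 v - sqY n v) <= (sqy n.+1 - sqy n) * nr v.
Proof.
elim: n v => [|n ih] v.
  rewrite /= addr0 subr0 subr0 expr0n addr0 nr_rc ger0_norm ?invr_ge0//.
  by rewrite mul1r ler_wpM2l// invr_ge0.
(* Difference of two squares of operators, split by inserting the mixed product; the induction
   hypothesis applies once at [v] and once at [sqY n v]. *)
have -> : sqY n.+2 v - sqY n.+1 v = rc 2^-1 *:
    (sqY n.+1 (sqY n.+1 v - sqY n v) + (sqY n.+1 (sqY n v) - sqY n (sqY n v))).
  rewrite (linopB (sqY_linear n.+1)) subrKA.
  have e k : sqY k.+1 v = rc 2^-1 *: (S v + sqY k (sqY k v)) by [].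
  by rewrite (e n.+1) [X in _ - X = _](e n) -scalerBr opprD addrACA subrr add0r.
have -> : sqy n.+2 - sqy n.+1 = (sqy n.+1 + sqy n) * (sqy n.+1 - sqy n) / 2.
  have e k : sqy k.+1 = (1 + sqy k ^+ 2) / 2 by [].
  by rewrite (e n.+1) [X in _ - X = _](e n); field.
rewrite nr_rc ger0_norm ?invr_ge0//.
have /andP[y0 _] := sqy_itv n.+1; have /andP[z0 _] := sqy_itv n.
have h1 := sqY_le n.+1 (sqY n.+1 v - sqY n v).
have h2 := ler_wpM2l y0 (ih v); have h3 := ih (sqY n v).
have h4 := nrD (sqY n.+1 (sqY n.+1 v - sqY n v))
               (sqY n.+1 (sqY n v) - sqY n (sqY n v)).
have h5 : (sqy n.+1 - sqy n) * nr (sqY n v) <= (sqy n.+1 - sqy n) * (sqy n * nr v).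
  apply: ler_wpM2l (sqY_le n v).
  have /andP[? ?] := sqy_itv n; rewrite subr_ge0 /=; nra.
lra.
Qed.

Lemma sqY_cauchy n k v :
  nr (sqY (n + k) v - sqY n v) <= (sqy (n + k) - sqy n) * nr v.
Proof.
elim: k => [|k ih]; first by rewrite addn0 !subrr nr0 mul0r.
rewrite addnS; apply: (le_trans (nr_dist (sqY (n + k) v) _ _)).
have := sqY_step (n + k) v; lra.
Qed.

Lemma sqy_mono n k : sqy n <= sqy (n + k).
Proof.
elim: k => [|k ih]; first by rewrite addn0.
by rewrite addnS; apply: (le_trans ih) => /=; have := sqy_itv (n + k); nra.
Qed.

Lemma sqy_cauchy eps : 0 < eps -> exists N, forall n k, (N <= n)%N ->
  sqy (n + k) - sqy n < eps.
Proof.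
move=> e0.
have hs : has_sup (range sqy).
  split; first by exists 0, 0%N.
  by exists 1 => _ [n _ <-]; have /andP[] := sqy_itv n.
have [_ [N _ <-] hN] := sup_adherent e0 hs.
exists N => n k /subnKC <-; rewrite ltrBlDr.
have h1 : sqy (N + (n - N) + k) <= sup (range sqy).
  by apply: ub_le_sup; [exact: hs.2 | exists (N + (n - N) + k)%N].
have := sqy_mono N (n - N)%N; lra.
Qed.

Lemma sqY_lim : exists Y : Hs -> Hs, forall v eps, 0 < eps ->
  exists N, forall n, (N <= n)%N -> nr (sqY n v - Y v) < eps.
Proof.
suff h0 : forall v, exists l, forall eps, 0 < eps ->
    exists N, forall n, (N <= n)%N -> nr (sqY n v - l) < eps.
  by have [Y hY] := choice h0; exists Y.
move=> v; apply: nr_complete => eps e0.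
have c1 : 0 < nr v + 1 by rewrite ltr_wpDl ?nr_ge0.
have [|N hN] := @sqy_cauchy (eps / (2 * (nr v + 1))).
  by rewrite divr_gt0// mulr_gt0.
have h n : (N <= n)%N -> nr (sqY n v - sqY N v) < eps / 2.
  move=> /subnKC <-; apply: (le_lt_trans (sqY_cauchy _ _ _)).
  apply: (@le_lt_trans _ _ ((sqy (N + (n - N)) - sqy N) * (nr v + 1))).
    by rewrite ler_wpM2l ?lerDl// subr_ge0 sqy_mono.
  have := hN N (n - N)%N (leqnn _); rewrite -(ltr_pM2r c1) => /lt_le_trans; apply.
  by rewrite invfM mulrA mulfVK// gt_eqF.
exists N => n k Nn Nk; apply: (le_lt_trans (nr_dist (sqY N v) _ _)).
have := h n Nn; have := h k Nk; rewrite (nrB (sqY N v)); lra.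
Qed.

Lemma sqY_limit : exists Y : Hs -> Hs,
  [/\ linear Y, forall v, nr (Y v) <= nr v,
      forall u v, re (Y u) v = re u (Y v)
    & forall v, Y v = rc 2^-1 *: (S v + Y (Y v))].
Proof.
have [Y hY] := sqY_lim.
have lY : linear Y.
  move=> a u v; apply/eqP; rewrite -subr_eq0; apply/eqP/nr_eq0.
  apply/eqP; rewrite eq_le nr_ge0 andbT.
  apply: (@le_eps _ _ _ (modulus a + 2)); first by rewrite addr_ge0// modulus_ge0.
  move=> eps e0.
  have [N1 h1] := hY u _ e0; have [N2 h2] := hY v _ e0.
  have [N3 h3] := hY (a *: u + v) _ e0; pose n := maxn N1 (maxn N2 N3).
  have {}h1 := h1 n (leq_maxl _ _).
  have {}h2 : nr (sqY n v - Y v) < eps.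
    by apply: h2; rewrite /n maxnCA leq_maxl.
  have {}h3 : nr (sqY n (a *: u + v) - Y (a *: u + v)) < eps.
    by apply: h3; rewrite /n maxnA leq_maxr.
  have -> : Y (a *: u + v) - (a *: Y u + Y v) =
      (Y (a *: u + v) - sqY n (a *: u + v)) + (a *: (sqY n u - Y u) + (sqY n v - Y v)).
    by rewrite sqY_linear scalerBr [in RHS](addrACA (a *: _)) -opprD subrKA.
  apply: (le_trans (nrD _ _)).
  have h4 := nrD (a *: (sqY n u - Y u)) (sqY n v - Y v).
  rewrite nrZ in h4; rewrite (nrB (Y _)).
  have h5 := ler_wpM2l (modulus_ge0 a) (ltW h1).
  lra.
have cY v : nr (Y v) <= nr v.
  apply: (@le_eps _ _ _ 1) => // eps /(hY v)[N /(_ N (leqnn _)) hN].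
  have := nrD (Y v - sqY N v) (sqY N v); rewrite subrK nrB.
  have := sqY_le N v; have /andP[_ y1] := sqy_itv N.
  have := ler_wpM2r (nr_ge0 v) y1; lra.
exists Y; split=> //.
- move=> u v; apply/eqP; rewrite -subr_eq0 -normr_eq0 eq_le normr_ge0 andbT.
  apply: (@le_eps _ _ _ (nr u + nr v)); first by rewrite addr_ge0// nr_ge0.
  move=> eps e0; have [N1 h1] := hY u _ e0; have [N2 h2] := hY v _ e0.
  pose n := maxn N1 N2.
  have {}h1 := ltW (h1 n (leq_maxl _ _)); have {}h2 := ltW (h2 n (leq_maxr _ _)).
  have -> : re (Y u) v - re u (Y v) =
     re u (sqY n v - Y v) - re (sqY n u - Y u) v.
    by rewrite !reE sqY_sym; lra.
  apply: (le_trans (ler_normB _ _)).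
  have := re_le_abs hip u (sqY n v - Y v); have := re_le_abs hip (sqY n u - Y u) v.
  have := ler_wpM2l (nr_ge0 u) h2; have := ler_wpM2r (nr_ge0 v) h1; lra.
- move=> v; apply/eqP; rewrite -subr_eq0; apply/eqP/nr_eq0.
  apply/eqP; rewrite eq_le nr_ge0 andbT.
  apply: (@le_eps _ _ _ 3) => // eps e0.
  have [N1 h1] := hY v _ e0; have [N2 h2] := hY (Y v) _ e0.
  pose n := maxn N1 N2.
  (* [Y v] is compared with iterate [n.+1], which unfolds into iterate [n]. *)
  have {}h2 := h2 n (leq_maxr _ _); have h3 := h1 n.+1 (leqW (leq_maxl _ _)).
  have {}h1 := h1 n (leq_maxl _ _).
  have -> : Y v - rc 2^-1 *: (S v + Y (Y v)) = (Y v - sqY n.+1 v) +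
     rc 2^-1 *: (sqY n (sqY n v - Y v) + (sqY n (Y v) - Y (Y v))).
    rewrite (linopB (sqY_linear n)) subrKA /= -[RHS]addrA; congr (_ + _).
    by rewrite -!scalerN -scalerDr; congr (_ *: _); rewrite !opprD subrKA.
  have := nrD (Y v - sqY n.+1 v)
     (rc 2^-1 *: (sqY n (sqY n v - Y v) + (sqY n (Y v) - Y (Y v)))).
  rewrite nr_rc ger0_norm ?invr_ge0// (nrB (Y v)).
  have := nrD (sqY n (sqY n v - Y v)) (sqY n (Y v) - Y (Y v)).
  have := sqY_le n (sqY n v - Y v); have /andP[_ y1] := sqy_itv n.
  have := ler_wpM2r (nr_ge0 (sqY n v - Y v)) y1; lra.
Qed.

End SquareRoot.
(** The operator inequality [T^2 <= M T], from positivity at [v - rc M^-1 *: T v]. It makes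
    [1 - T / M] a contraction, as the iteration requires. *)
Lemma positive_sqr_le (T : Hs -> Hs) (M : R) : positive_op ip T -> 0 < M ->
  (forall v, nr (T v) <= M * nr v) -> forall v, nr (T v) ^+ 2 <= M * re (T v) v.
Proof.
move=> pT M0 hT v.
have sT := adjoint_pair_re (positive_symmetric pT).
have lT : linear T by case: pT => -[].
have h1 := positive_re (v - rc M^-1 *: T v) pT.
have h2 : re (T (T v)) (T v) <= M * nr (T v) ^+ 2.
  by apply: (le_trans (re_le hip _ _)); rewrite expr2 mulrA ler_wpM2r// nr_ge0.
move: h1; rewrite linopB// linopZ// !reE (sT (T v) v) !(re_vv hip).
set a := re (T v) v; set b := nr (T v) ^+ 2 in h2 *; set c := re _ _ in h2 *.
move=> h1.
have h3 := ler_wpM2l (ltW (mulr_gt0 M0 M0)) h1.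
have e : M * M * (a - M^-1 * b - (M^-1 * b - M^-1 * (M^-1 * c))) =
   M * M * a - 2 * M * b + c by field; rewrite gt_eqF.
have : M * b <= M * (M * a) by move: h3; rewrite mulr0; lra.
by rewrite ler_pM2l.
Qed.

Lemma positive_sqrt (T : Hs -> Hs) : positive_op ip T ->
  exists Q, positive_op ip Q /\ Q \o Q = T.
Proof.
move=> pT; have [bT _] := pT; have [lT [K K0 hK]] := (bounded_opP _).1 bT.
pose M := K + 1; have M0 : 0 < M by rewrite ltr_wpDl.
have hM v : nr (T v) <= M * nr v.
  by apply: (le_trans (hK v)); rewrite ler_wpM2r ?nr_ge0// lerDl.
have sT := adjoint_pair_re (positive_symmetric pT).
(* With this [S], the limit [Y] satisfies [(1 - Y)^2 = 1 - S = T / M], whence the root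
   [sqrt M * (1 - Y)]. *)
pose S v := v - rc M^-1 *: T v.
have lS : linear S.
  move=> a u v; rewrite /S lT scalerDr opprD addrACA; congr (_ + _).
  by rewrite scalerBr !scalerA mulrC.
have sS u v : re (S u) v = re u (S v) by rewrite /S !reE sT.
have cS v : nr (S v) <= nr v.
  rewrite -(@ler_pXn2r _ 2)// ?nnegrE ?nr_ge0// /S (nr_sqrB hip) nr_rc exprMn.
  rewrite real_normK ?num_real// reZr (reC _ v).
  have h := positive_sqr_le pT M0 hM v.
  have M2 : 0 <= M^-1 ^+ 2 by exact: sqr_ge0.
  have := ler_wpM2l M2 h.
  have -> : M^-1 ^+ 2 * (M * re (T v) v) = M^-1 * re (T v) v by field; rewrite gt_eqF.
  have : 0 <= M^-1 * re (T v) v.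
    by rewrite mulr_ge0 ?(positive_re v pT)// invr_ge0 ltW.
  lra.
have [Y [lY cY sY eY]] := sqY_limit lS sS cS.
pose q := Num.sqrt M.
have q0 : 0 < q by rewrite sqrtr_gt0.
pose Q v := rc q *: (v - Y v).
have lQ : linear Q.
  move=> a u v; rewrite /Q lY opprD (addrACA (a *: u)).
  by rewrite !scalerDr !scalerN !scalerA !(mulrC a).
have sQ : adjoint_pair Q Q.
  by apply: symmetric_from_re => // u v; rewrite /Q !reE sY.
exists Q; split; last first.
  apply/funext => v /=; rewrite /Q (linopZ lY) (linopB lY) -scalerBr scalerA -rcM.
  rewrite -expr2 sqr_sqrtr ?ltW//.
  have -> : T v = rc M *: (v - S v).
    by rewrite /S subKr scalerA -rcM mulfV ?gt_eqF// scale1r.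
  congr (_ *: _).
  have : rc 2 *: Y v = S v + Y (Y v).
    by rewrite {1}eY scalerA -rcM mulfV ?scale1r ?pnatr_eq0.
  rewrite (_ : rc 2 = 2%:R); last by rewrite /rc rmorph_nat.
  rewrite scaler_nat mulr2n => e2.
  have -> : S v = Y v + Y v - Y (Y v) by rewrite e2 addrK.
  by rewrite -addrA -opprD addrA.
split.
  apply/bounded_opP; split=> //; exists (q * 2) => [|v]; first by rewrite mulr_ge0// ltW.
  rewrite nr_rc (ger0_norm (ltW q0)) -mulrA ler_pM2l//.
  apply: (le_trans (nrD _ _)); rewrite nrN; have := cY v; lra.
(* The complex order asks for a zero imaginary part, which is symmetry of [Q], and a nonnegative
   real part, which follows from [Y] being a contraction. *)
move=> v; rewrite ip_re lecE /=.
have -> : re (Q v) (ii R *: v) = 0.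
  have : complex.Im (ip (Q v) v) = - complex.Im (ip (Q v) v).
    by rewrite {1}(sQ v v) ipC conjE; case: (ip (Q v) v).
  by rewrite Im_ip; lra.
rewrite /ii /rc /= !mul0r !mulr0 !addr0 subr0 eqxx /= addr0.
rewrite /Q reZl mulr_ge0 ?(ltW q0)// reDl reNl subr_ge0 (re_vv hip).
by apply: (le_trans (re_le hip _ _)); rewrite expr2 ler_wpM2r// nr_ge0.
Qed.

End Operators.

(** * Extended sums and their finite subsums *)

Section FiniteSums.
Variables (R : realType) (I : choiceType).

Lemma le_fset_esum (E : set I) (a : I -> R) (F : {fset I}) :
  (forall e, e \in F -> E e) ->
  ((\sum_(e <- F) a e)%:E <= \esum_(e in E) (a e)%:E)%E.
Proof.
move=> FE; apply: ereal_sup_ubound; exists [set` F].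
  by split; [exact: finite_fset | move=> e /=; exact: FE].
by rewrite fsbig_finite//= set_fsetK sumEFin.
Qed.

Lemma esum_le_fset (E : set I) (a : I -> R) (b : \bar R) :
  (forall F : {fset I}, (forall e, e \in F -> E e) ->
    ((\sum_(e <- F) a e)%:E <= b)%E) ->
  (\esum_(e in E) (a e)%:E <= b)%E.
Proof.
move=> h; apply: ge_ereal_sup => _ [A [fA AE] <-].
rewrite fsbig_finite//= sumEFin; apply: h => e.
by rewrite in_fset_set// inE; exact: AE.
Qed.

Lemma esum_exchange (J : choiceType) (E : set I) (D : set J) (a : I -> J -> \bar R) :
  (forall i j, (0 <= a i j)%E) ->
  (\esum_(i in E) \esum_(j in D) a i j = \esum_(j in D) \esum_(i in E) a i j)%E.
Proof.
move=> a0; rewrite !esum_esum//.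
rewrite (@reindex_esum _ _ _ (D `*`` (fun=> E)) _ (fun k => (k.2, k.1)))//.
split.
- by move=> [i j] [].
- by move=> [i j] [k l] _ _ [-> ->].
- by move=> [i j] [/= Ei Dj]; exists (j, i).
Qed.

End FiniteSums.

(** * Bessel, Parseval and the Hilbert-Schmidt norm *)

Section Basis.
Variables (R : realType) (Hs : completeNormedModType (Cx R)).
Variable ip : {dot Hs for Num.conj}.
Hypothesis hip : hilbert_form ip.
Local Notation re := (@re R Hs ip).

Variable E : set Hs.
Hypothesis onE : orthonormal_basis ip E.

Definition proj_fset (F : {fset Hs}) (v : Hs) : Hs := \sum_(e <- F) ip v e *: e.

Definition coef_sqr (v e : Hs) : R := modulus (ip v e) ^+ 2.

Lemma coef_sqr_ge0 v e : 0 <= coef_sqr v e.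
Proof. exact: sqr_ge0. Qed.

Lemma coef_sqrC v e : coef_sqr v e = coef_sqr e v.
Proof.
by rewrite /coef_sqr ipC /modulus norm_conjC.
Qed.

Lemma coef_sqrE v e : coef_sqr v e = complex.Re (ip v e * (ip v e)^*).
Proof. by rewrite -normCK modulusE -[_%:C%C]/(rc _) expr2 -rcM. Qed.

Lemma ip_sumr (F : {fset Hs}) (c : Hs -> Cx R) w :
  (forall e, e \in F -> ip w e = 0) -> ip w (\sum_(e <- F) c e *: e) = 0.
Proof.
move=> h; rewrite linear_sumr big_seq big1// => e eF.
by rewrite linearZr_LR /= h// mulr0.
Qed.

Lemma ip_proj_fset (F : {fset Hs}) v f : (forall e, e \in F -> E e) -> E f ->
  ip (proj_fset F v) f = if f \in F then ip v f else 0.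
Proof.
move=> FE Ef; rewrite /proj_fset linear_sumlz; case: ifPn => fF.
  rewrite (big_fsetD1 f)//= linearZl_LR /= (onE.1 f f)// eqxx mulr1 big_seq big1 ?addr0//.
  move=> e; rewrite in_fsetD1 => /andP[ef /FE Ee].
  by rewrite linearZl_LR /= (onE.1 e f)// (negbTE ef) mulr0.
rewrite big_seq big1// => e eF; rewrite linearZl_LR /= (onE.1 e f)//; last exact: FE.
by case: eqVneq eF fF => [->|_ _ _]; [move=> -> | rewrite mulr0].
Qed.

Lemma proj_fset_orth (F : {fset Hs}) v f : (forall e, e \in F -> E e) ->
  f \in F -> ip (v - proj_fset F v) f = 0.
Proof.
by move=> FE fF; rewrite linearBl /= ip_proj_fset ?fF ?subrr//; exact: FE.
Qed.

Lemma nr_proj_fset (F : {fset Hs}) v : (forall e, e \in F -> E e) ->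
  nr (v - proj_fset F v) ^+ 2 = nr v ^+ 2 - \sum_(e <- F) coef_sqr v e.
Proof.
move=> FE; set s := proj_fset F v.
have h : re (v - s) s = 0.
  by rewrite /re ip_sumr// => e eF; exact: proj_fset_orth.
have h2 : re v s = \sum_(e <- F) coef_sqr v e.
  rewrite /re /s /proj_fset linear_sumr.
  rewrite (big_morph _ (@ReD R) (erefl : complex.Re (0 : Cx R) = 0)).
  by apply: eq_bigr => e _; rewrite linearZr_LR /= coef_sqrE mulrC.
move: h; rewrite reDl reNl (re_vv hip) => h.
by rewrite (nr_sqrB hip) -h2; lra.
Qed.

Lemma nr_proj_fsetB (F K : {fset Hs}) v : (forall e, e \in K -> E e) ->
  (F `<=` K)%fset ->
  nr (proj_fset K v - proj_fset F v) ^+ 2 =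
  \sum_(e <- K) coef_sqr v e - \sum_(e <- F) coef_sqr v e.
Proof.
move=> KE /fsubsetP FK; have FE e : e \in F -> E e by move=> /FK/KE.
have h1 := nr_proj_fset v KE; have h2 := nr_proj_fset v FE.
have h3 : re (v - proj_fset K v) (proj_fset K v - proj_fset F v) = 0.
  rewrite /re linearBr /= !ip_sumr ?subrr// => e eF; apply: proj_fset_orth => //.
  exact: FK.
have e : v - proj_fset F v =
   (v - proj_fset K v) + (proj_fset K v - proj_fset F v) by rewrite subrKA.
by move: h2; rewrite e (nr_sqrD hip) h3; lra.
Qed.

Lemma bessel (F : {fset Hs}) v : (forall e, e \in F -> E e) ->
  \sum_(e <- F) coef_sqr v e <= nr v ^+ 2.
Proof. by move=> /(nr_proj_fset v) h; rewrite -subr_ge0 -h sqr_ge0. Qed.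

(** [E] may be uncountable, so finite subsets are chosen whose Bessel sums approach the supremum.
    The projections of [v] onto them are Cauchy, and their limit [l] leaves [v - l] orthogonal to
    [E]; maximality gives [v = l]. *)
Lemma parseval v : (\esum_(e in E) (coef_sqr v e)%:E)%E = (nr v ^+ 2)%:E.
Proof.
apply/eqP; rewrite eq_le; apply/andP; split.
  by apply: esum_le_fset => F FE; rewrite lee_fin; exact: bessel.
pose fam := [set F : {fset Hs} | forall e, e \in F -> E e].
pose sums := [set \sum_(e <- F) coef_sqr v e | F in fam].
have fam0 : fam fset0 by move=> e; rewrite in_fset0.
have famU F K : fam F -> fam K -> fam (F `|` K)%fset.
  by move=> hF hK e; rewrite in_fsetU => /orP[/hF|/hK].
have hs : has_sup sums.
  split; first by exists (\sum_(e <- fset0) coef_sqr v e), fset0.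
  by exists (nr v ^+ 2) => _ [F FE <-]; exact: bessel.
have le_sup F : fam F -> \sum_(e <- F) coef_sqr v e <= sup sums.
  by move=> FE; apply: ub_le_sup; [exact: hs.2 | exists F].
have /choice[F hF] : forall n, exists F, fam F /\
    sup sums - n.+1%:R^-1 < \sum_(e <- F) coef_sqr v e.
  move=> n; have [] := @sup_adherent _ sums n.+1%:R^-1 _ hs.
    by rewrite invr_gt0 ltr0n.
  by move=> _ [F FE <-] h; exists F.
have sq_lt (a b : R) : 0 <= b -> a ^+ 2 < b ^+ 2 -> a < b.
  by move=> b0 ab; rewrite ltNge; apply/negP => ba; nra.
have [l hl] : exists l, forall eps, 0 < eps -> exists N, forall n, (N <= n)%N ->
    nr (proj_fset (F n) v - l) < eps.
  apply: nr_complete => eps e0.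
  have [|N hN] := natSinv_small (eps := eps ^+ 2 / 4).
    by rewrite divr_gt0// exprn_gt0.
  exists N => n k Nn Nk; have [Fn sn] := hF n; have [Fk sk] := hF k.
  (* The projection onto the union differs from each of the two by at most the gap of that Bessel
     sum to the supremum. *)
  pose K := (F n `|` F k)%fset; have KE : fam K by exact: famU.
  have h n' : (N <= n')%N -> (F n' `<=` K)%fset ->
      nr (proj_fset K v - proj_fset (F n') v) < eps / 2.
    move=> Nn' FK; apply: sq_lt; first by rewrite divr_ge0// ltW.
    rewrite nr_proj_fsetB//; have := le_sup _ KE; have := hN n' Nn'.
    have [_] := hF n'; move: (n'.+1%:R^-1) => x; lra.
  apply: (le_lt_trans (nr_dist (proj_fset K v) _ _)).
  have := h n Nn (fsubsetUl _ _); have := h k Nk (fsubsetUr _ _).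
  by rewrite (nrB _ (proj_fset (F n) v)); lra.
have orth e : E e -> ip (v - l) e = 0.
  move=> Ee; suff : modulus (ip (v - l) e) <= 0.
    move=> h; apply/normr0_eq0; rewrite modulusE; congr (_%:C)%C.
    by apply/eqP; rewrite eq_le h modulus_ge0.
  have ne : nr e = 1.
    have : nr e ^+ 2 = 1 by rewrite -(re_vv hip) /re (onE.1 e e)// eqxx.
    by move=> /eqP; rewrite sqrf_eq1 => /orP[/eqP //|/eqP h]; have := nr_ge0 e; lra.
  apply: (@le_eps _ _ _ 2) => // eps e0.
  have [N1 h1] := hl eps e0.
  have [|N2 h2] := natSinv_small (eps := eps ^+ 2); first by rewrite exprn_gt0.
  pose n := maxn N1 N2.
  have {}h1 := h1 n (leq_maxl _ _); have {}h2 := h2 n (leq_maxr _ _).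
  have [Fn sn] := hF n.
  have -> : ip (v - l) e =
     ip (v - proj_fset (F n) v) e + ip (proj_fset (F n) v - l) e.
    by rewrite -linearDl subrKA.
  apply: (le_trans (modulusD _ _)).
  have c1 : modulus (ip (proj_fset (F n) v - l) e) <= eps.
    apply: ltW; apply: sq_lt (ltW e0) _.
    rewrite -[X in X < _]/(coef_sqr _ _).
    have := @bessel [fset e]%fset (proj_fset (F n) v - l).
    rewrite big_seq_fset1 => h; apply: (le_lt_trans (h _)).
      by move=> f; rewrite in_fset1 => /eqP ->.
    by rewrite ltr_pXn2r// ?nnegrE ?nr_ge0 ?ltW.
  have c2 : modulus (ip (v - proj_fset (F n) v) e) <= eps.
    apply: ltW; apply: sq_lt (ltW e0) _.
    have [eF|eF] := boolP (e \in F n).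
      by rewrite proj_fset_orth// /modulus normr0 expr0n exprn_gt0.
    rewrite linearBl /= ip_proj_fset// (negbTE eF) subr0.
    (* Adjoining [e] to [F n] cannot exceed the supremum, so the coefficient at a missing [e] is
       small. *)
    have := le_sup (e |` F n)%fset; rewrite big_fsetU1// -/(coef_sqr v e) => h.
    have {}h : coef_sqr v e + \sum_(i <- F n) coef_sqr v i <= sup sums.
      by apply: h => f; rewrite in_fset1U => /orP[/eqP ->//|/Fn].
    move: (n.+1%:R^-1) h2 sn => x; lra.
  lra.
have vl : v = l by apply/eqP; rewrite -subr_eq0; apply/eqP/(onE.2 _ orth).
apply/lee_addgt0Pr => eps e0.
have [|N /(_ N (leqnn _)) hN] := hl (Num.sqrt eps); first by rewrite sqrtr_gt0.
have [FN _] := hF N.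
have := le_fset_esum (coef_sqr v) FN.
rewrite -(leeD2rE _ _ (isT : eps%:E \is a fin_num)) => /(le_trans _); apply.
rewrite -EFinD lee_fin; move: hN; rewrite -vl nrB => hN.
have := nr_proj_fset v FN.
have : nr (v - proj_fset (F N) v) ^+ 2 < eps.
  by rewrite -[ltRHS]sqr_sqrtr ?(ltW e0)// ltr_pXn2r// ?nnegrE ?nr_ge0 ?sqrtr_ge0.
lra.
Qed.

(** The square of the Hilbert-Schmidt norm, possibly infinite. *)
Definition hs (A : Hs -> Hs) : \bar R := (\esum_(e in E) (nr (A e) ^+ 2)%:E)%E.

(** By Parseval both sides are the double sum of [|ip (A e) f|^2] over the basis, in the two orders
    of summation. *)
Lemma hs_adjoint (A B : Hs -> Hs) : adjoint_pair ip A B -> hs A = hs B.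
Proof.
move=> AB; rewrite /hs.
under eq_esum do rewrite -parseval.
under [in RHS]eq_esum do rewrite -parseval.
rewrite esum_exchange => [|i j]; last by rewrite lee_fin coef_sqr_ge0.
apply: eq_esum => e _; apply: eq_esum => f _.
by rewrite [in RHS]coef_sqrC /coef_sqr AB.
Qed.

End Basis.

(* Unconditional sums of complex families *)
#[local] Existing Instance summability.totally_filter.

Section UnconditionalSums.
Variables (R : realType) (Hs : completeNormedModType (Cx R)) (E : set Hs).

(** A relation that records convergence along with the value, since the limit in [trace] is
    meaningful only for a convergent family. *)
Definition sums (f : Hs -> Cx R) (l : Cx R) : Prop :=
  summability.partial_sum (fun e => if e \in E then f e else 0)
    @ summability.totally --> l.

Lemma partial_sumE (f : Hs -> Cx R) (F : {fset Hs}) :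
  summability.partial_sum (fun e => if e \in E then f e else 0) F =
  \sum_(e <- [fset e in F | e \in E]%fset) f e.
Proof.
rewrite /summability.partial_sum.
rewrite -(big_seq_fsetE _ _ xpredT (fun e => if e \in E then f e else 0)).
by rewrite -big_mkcond big_fset_condE.
Qed.

Lemma partial_sum_family (F : {fset Hs}) e :
  e \in [fset e in F | e \in E]%fset -> E e.
Proof. by rewrite !inE /= => /andP[_]; rewrite inE. Qed.

Lemma sums_ext (f g : Hs -> Cx R) l :
  (forall e, E e -> f e = g e) -> sums f l -> sums g l.
Proof.
move=> fg; rewrite /sums; set a := fun e => _; set b := fun e => _.
suff -> : a = b by [].
by apply/funext => e; rewrite /a /b; case: ifPn => //; rewrite inE => /fg.
Qed.

Lemma sumsD (f g : Hs -> Cx R) a b :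
  sums f a -> sums g b -> sums (fun e => f e + g e) (a + b).
Proof.
move=> fa gb; rewrite /sums.
have -> : summability.partial_sum (fun e => if e \in E then f e + g e else 0) =
  (fun F => summability.partial_sum (fun e => if e \in E then f e else 0) F +
            summability.partial_sum (fun e => if e \in E then g e else 0) F).
  by apply/funext => F; rewrite !partial_sumE big_split.
exact: (cvgD fa gb).
Qed.

Lemma sumsZ (f : Hs -> Cx R) a c : sums f a -> sums (fun e => c * f e) (c * a).
Proof.
move=> fa; rewrite /sums.
have -> : summability.partial_sum (fun e => if e \in E then c * f e else 0) =
  (fun F => c * summability.partial_sum (fun e => if e \in E then f e else 0) F).
  by apply/funext => F; rewrite !partial_sumE mulr_sumr.
exact: (cvgM (cvg_cst c) fa).
Qed.

Lemma sumsB (f g : Hs -> Cx R) a b :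
  sums f a -> sums g b -> sums (fun e => f e - g e) (a - b).
Proof.
move=> fa gb; have {}gb := sumsZ (c := -1) gb; have := sumsD fa gb; rewrite mulN1r.
by apply: sums_ext => e _; rewrite mulN1r.
Qed.

Lemma sums_unique (f : Hs -> Cx R) a b : sums f a -> sums f b -> a = b.
Proof. by move=> fa fb; apply: (cvg_unique _ fa fb); exact: norm_hausdorff. Qed.

Lemma sums0 : sums (fun=> 0) 0.
Proof.
rewrite /sums.
have -> : summability.partial_sum (fun e : Hs => if e \in E then 0 else 0 : Cx R) = cst 0.
  by apply/funext => F; rewrite partial_sumE big1.
exact: cvg_cst.
Qed.

Lemma sums_sum n (f : 'I_n -> Hs -> Cx R) (l : 'I_n -> Cx R) :
  (forall i, sums (f i) (l i)) ->
  sums (fun e => \sum_(i < n) f i e) (\sum_(i < n) l i).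
Proof.
elim: n f l => [|n ih] f l h.
  by rewrite big_ord0; apply: sums_ext sums0 => e _; rewrite big_ord0.
rewrite big_ord_recl.
apply: sums_ext (sumsD (h ord0) (ih _ _ (fun i => h (lift ord0 i)))).
by move=> e _; rewrite big_ord_recl.
Qed.

Lemma sums_le (f : Hs -> Cx R) l b : sums f l ->
  (forall F : {fset Hs}, (forall e, e \in F -> E e) ->
     modulus (\sum_(e <- F) f e) <= b) -> modulus l <= b.
Proof.
move=> fl fb; apply/ler_addgt0Pr => eps e0.
move/cvgrPdist_lt : fl => /(_ (rc eps)); rewrite lt_rc => /(_ e0)[F0 _ hF].
have := hF F0 (fsubset_refl _); rewrite partial_sumE.
set s := \sum_(_ <- _) _ => h.
have {}h : modulus (l - s) < eps by rewrite -lt_rc -[rc _]modulusE.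
have := fb _ (@partial_sum_family F0); rewrite -/s.
by have := modulusD (l - s) s; rewrite subrK; lra.
Qed.

(** Links the supremum of finite sums to the unconditional limit: once a finite set exceeds
    [s - eps], monotonicity keeps all larger ones between [s - eps] and [s]. *)
Lemma sums_ge0 (a : Hs -> R) (s : R) : (forall e, 0 <= a e) ->
  (\esum_(e in E) (a e)%:E)%E = s%:E -> sums (fun e => rc (a e)) (rc s).
Proof.
move=> a0 es; apply/cvgrPdist_lt => eps e0.
have ie : eps = rc (complex.Re eps) by rewrite /rc RRe_real // gtr0_real.
rewrite ie lt_rc in e0; rewrite ie; move: (complex.Re eps) e0 => {ie}eps e0.
have [F0 F0E hF0] : exists2 F0 : {fset Hs}, (forall e, e \in F0 -> E e) &
    s - eps < \sum_(e <- F0) a e.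
  have : ((s - eps)%:E < \esum_(e in E) (a e)%:E)%E.
    by rewrite es lte_fin ltrBlDr ltrDl.
  move=> /ereal_sup_gt[_ [A [fA AE] <-]].
  rewrite fsbig_finite//= sumEFin lte_fin => h; exists (fset_set A) => // e.
  by rewrite in_fset_set// inE; exact: AE.
exists F0 => // F /= /fsubsetP FF.
rewrite partial_sumE; set G := [fset e in F | e \in E]%fset.
have GE e : e \in G -> E e by exact: partial_sum_family.
have GF : (F0 `<=` G)%fset.
  by apply/fsubsetP => e eF; rewrite !inE /= FF//= mem_set//; exact: F0E.
have -> : \sum_(e <- G) rc (a e) = rc (\sum_(e <- G) a e).
  by rewrite (big_morph _ (@rcD R) (@rc0 R)).
rewrite -rcB normc_def /rc /= expr0n addr0 sqrtr_sqr ltcR.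
have h1 : \sum_(e <- G) a e <= s by have := le_fset_esum a GE; rewrite es lee_fin.
have h2 : \sum_(e <- F0) a e <= \sum_(e <- G) a e.
  have -> : \sum_(e <- F0) a e = \sum_(e <- G) (if e \in F0 then a e else 0).
    rewrite -(big_fset_incl _ GF) => [|e _ /negbTE ->//].
    by rewrite big_seq [RHS]big_seq; apply: eq_bigr => e ->.
  by apply: ler_sum => e _; case: ifP.
rewrite ger0_norm; lra.
Qed.

End UnconditionalSums.

(** * Products of two Hilbert-Schmidt operators *)

Section HilbertSchmidt.
Variables (R : realType) (Hs : completeNormedModType (Cx R)).
Variable ip : {dot Hs for Num.conj}.
Hypothesis hip : hilbert_form ip.
Local Notation re := (@re R Hs ip).
Local Notation i := (ii R).

Variable E : set Hs.
Hypothesis onE : orthonormal_basis ip E.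
Local Notation hs := (hs E).

Lemma hs_le (A B : Hs -> Hs) (M t : R) :
  (forall v, nr (A v) <= M * nr (B v)) -> 0 <= M -> hs B = t%:E ->
  (hs A <= (M ^+ 2 * t)%:E)%E.
Proof.
move=> AB M0 hB; apply: esum_le_fset => F FE; rewrite lee_fin.
have := le_fset_esum (fun e => nr (B e) ^+ 2) FE.
rewrite -/(hs B) hB lee_fin => h.
apply: (@le_trans _ _ (M ^+ 2 * \sum_(e <- F) nr (B e) ^+ 2)); last first.
  by rewrite ler_wpM2l// sqr_ge0.
rewrite mulr_sumr ler_sum// => e _; rewrite -exprMn.
by rewrite ler_pXn2r// nnegrE ?mulr_ge0 ?nr_ge0.
Qed.

Lemma hs_ge0 (A : Hs -> Hs) : (0 <= hs A)%E.
Proof. by apply: esum_ge0 => e _; rewrite lee_fin sqr_ge0. Qed.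

Lemma hs_fin (A : Hs -> Hs) : (hs A < +oo)%E -> exists t : R, hs A = t%:E.
Proof.
move=> h; exists (fine (hs A)); rewrite fineK// ge0_fin_numE//; exact: hs_ge0.
Qed.

Lemma hsD_fin (A B : Hs -> Hs) (a b : R) (c : Cx R) :
  modulus c = 1 -> hs A = a%:E -> hs B = b%:E ->
  exists t : R, hs (fun v => A v + c *: B v) = t%:E.
Proof.
move=> c1 hA hB; apply: hs_fin.
apply: (@le_lt_trans _ _ (2 * a + 2 * b)%:E); last exact: ltry.
apply: esum_le_fset => F FE; rewrite lee_fin.
have h1 := le_fset_esum (fun e => nr (A e) ^+ 2) FE.
have h2 := le_fset_esum (fun e => nr (B e) ^+ 2) FE.
rewrite -/(hs A) hA lee_fin in h1; rewrite -/(hs B) hB lee_fin in h2.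
apply: (@le_trans _ _ (2 * (\sum_(e <- F) nr (A e) ^+ 2) +
                       2 * (\sum_(e <- F) nr (B e) ^+ 2))); last by lra.
rewrite !mulr_sumr -big_split; apply: ler_sum => e _ /=.
have := nrD (A e) (c *: B e); rewrite nrZ c1 mul1r.
have := nr_ge0 (A e + c *: B e); have := sqr_ge0 (nr (A e) - nr (B e)).
move: (nr (A e)) (nr (B e)) (nr (A e + _)) => x y z; nra.
Qed.

Lemma polarization x y : ip x y = rc 4^-1 *
  (rc (nr (x + 1 *: y) ^+ 2) - rc (nr (x + (- 1) *: y) ^+ 2)
   + i * (rc (nr (x + i *: y) ^+ 2) - rc (nr (x + (- i) *: y) ^+ 2))).
Proof.
rewrite !scaleNr !scale1r -!rcB !(nr_sqrD hip) !reNr !nrN ip_re.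
rewrite mulrDr mulrCA -!rcM; congr (rc _ + _ * rc _); lra.
Qed.

Lemma modulus_i : modulus i = 1.
Proof. by rewrite /modulus normc_def /= expr0n add0r expr1n sqrtr1. Qed.

Lemma modulusN (z : Cx R) : modulus (- z) = modulus z.
Proof. by rewrite /modulus normrN. Qed.

Lemma modulus1 : modulus (1 : Cx R) = 1.
Proof. by rewrite /modulus normr1. Qed.

Lemma hs_polar (X Y : Hs -> Hs) (s1 s2 s3 s4 : R) :
  hs (fun v => X v + 1 *: Y v) = s1%:E ->
  hs (fun v => X v + (- 1) *: Y v) = s2%:E ->
  hs (fun v => X v + i *: Y v) = s3%:E ->
  hs (fun v => X v + (- i) *: Y v) = s4%:E ->
  sums E (fun e => ip (X e) (Y e))
    (rc 4^-1 * (rc s1 - rc s2 + i * (rc s3 - rc s4))).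
Proof.
move=> h1 h2 h3 h4; apply: (@sums_ext _ _ _ (fun e => rc 4^-1 *
  (rc (nr (X e + 1 *: Y e) ^+ 2) - rc (nr (X e + (- 1) *: Y e) ^+ 2)
   + i * (rc (nr (X e + i *: Y e) ^+ 2) - rc (nr (X e + (- i) *: Y e) ^+ 2))))).
  by move=> e _; rewrite -polarization.
by apply: sumsZ; apply: sumsD; [|apply: sumsZ]; apply: sumsB;
  apply: sums_ge0 => // e; exact: sqr_ge0.
Qed.

Lemma adjoint_pairD (X X' Y Y' : Hs -> Hs) (c : Cx R) :
  adjoint_pair ip X X' -> adjoint_pair ip Y Y' ->
  adjoint_pair ip (fun v => X v + c *: Y v) (fun v => X' v + c^* *: Y' v).
Proof.
move=> hX hY u v.
by rewrite linearDl linearDr linearZl_LR linearZr_LR /= conjCK hX hY.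
Qed.

Lemma hs_phase (c : Cx R) (A B : Hs -> Hs) : modulus c = 1 ->
  (forall v, A v = c *: B v) -> hs A = hs B.
Proof. by move=> c1 AB; apply: eq_esum => e _; rewrite AB nrZ c1 mul1r. Qed.

(** The sums are the traces of [Y' X] and [X Y']. For each of the four phases [c], the adjoint of
    [X + c Y] is the conjugate of [c] times [Y' + c X'], so both have the same Hilbert-Schmidt norm
    and the two polarized sums agree term by term. *)
Lemma hs_trace_comm (X X' Y Y' : Hs -> Hs) (a b : R) :
  adjoint_pair ip X X' -> adjoint_pair ip Y Y' -> hs X = a%:E -> hs Y = b%:E ->
  exists l, sums E (fun e => ip (X e) (Y e)) l /\
            sums E (fun e => ip (Y' e) (X' e)) l.
Proof.
move=> XX YY hX hY.
have ci : i^* = - i by rewrite conjE /ii /=; apply/eqP; rewrite eq_complex /= oppr0 !eqxx.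
have cNi : (- i)^* = i.
  by rewrite conjE /ii /=; apply/eqP; rewrite eq_complex /= opprK oppr0 !eqxx.
have cN1 : (-1)^* = -1 :> Cx R.
  by rewrite -[1]/(rc 1) -rcN conjE /rc conjc_real.
have [s1 h1] := hsD_fin modulus1 hX hY.
have [|s2 h2] := hsD_fin (c := -1) _ hX hY; first by rewrite modulusN modulus1.
have [s3 h3] := hsD_fin modulus_i hX hY.
have [|s4 h4] := hsD_fin (c := - i) _ hX hY; first by rewrite modulusN modulus_i.
exists (rc 4^-1 * (rc s1 - rc s2 + i * (rc s3 - rc s4))); split; first exact: hs_polar.
have mN1 : modulus (-1 : Cx R) = 1 by rewrite modulusN modulus1.
have mNi : modulus (- i) = 1 by rewrite modulusN modulus_i.
have ii1 : i * i = -1 by rewrite -expr2 /ii sqr_i.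
apply: hs_polar.
- rewrite -h1 (hs_adjoint hip onE (adjoint_pairD (1) XX YY)) conjC1.
  by apply: (hs_phase modulus1) => v; rewrite !scale1r addrC.
- rewrite -h2 (hs_adjoint hip onE (adjoint_pairD (-1) XX YY)) cN1.
  by apply: (hs_phase mN1) => v; rewrite !scaleN1r opprD opprK addrC.
- rewrite -h3 (hs_adjoint hip onE (adjoint_pairD i XX YY)) ci.
  apply: (hs_phase modulus_i) => v.
  by rewrite scalerDr scalerA mulrN ii1 opprK scale1r addrC.
- rewrite -h4 (hs_adjoint hip onE (adjoint_pairD (- i) XX YY)) cNi.
  apply: (hs_phase mNi) => v.
  by rewrite scalerDr scalerA mulNr ii1 opprK scale1r addrC.
Qed.

End HilbertSchmidt.

(** * Trace class operators: cyclicity and the trace bound *)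

Section TraceClass.
Variables (R : realType) (Hs : completeNormedModType (Cx R)).
Variable ip : {dot Hs for Num.conj}.
Hypothesis hip : hilbert_form ip.
Local Notation re := (@re R Hs ip).

(** The factor 2 comes from bounding real and imaginary parts separately; it is exactly what
    [2 a b <= a^2 + b^2] absorbs later. *)
Lemma modulus_ip_le u v : modulus (ip u v) <= 2 * (nr u * nr v).
Proof.
rewrite ip_re; apply: (le_trans (modulusD _ _)).
rewrite modulusM modulus_i mul1r /modulus !normc_def /rc /= expr0n !addr0 !sqrtr_sqr.
have := re_le_abs hip u v; have := re_le_abs hip u (ii R *: v).
by rewrite nrZ modulus_i mul1r; lra.
Qed.

(** The equality of norms follows from [|A|^2 = A^* A]; it is the input for factoring [A] through
    [|A|]. *)
Lemma abs_op_spec (A : Hs -> Hs) : bounded_op A ->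
  positive_op ip (abs_op ip A) /\ forall v, nr (abs_op ip A v) = nr (A v).
Proof.
move=> bA; have [bA' adA] := adjoint_spec hip bA.
have pos : positive_op ip (adjoint ip A \o A).
  split; first exact: bounded_comp.
  by move=> v /=; rewrite ipC -adA -ipC ip_vv// -rc0 le_rc sqr_ge0.
have [Q [pQ QQ]] := positive_sqrt hip pos.
have [pP PP] : positive_op ip (abs_op ip A) /\
    abs_op ip A \o abs_op ip A = adjoint ip A \o A.
  by rewrite /abs_op; case: xgetP => [P _ //|/(_ Q)[]].
split=> // v.
apply/eqP; rewrite -(@eqrXn2 _ 2) ?nr_ge0// -!(re_vv hip); apply/eqP.
rewrite -(adjoint_pair_re (positive_symmetric pP)).
have -> : abs_op ip A (abs_op ip A v) = adjoint ip A (A v).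
  by rewrite -[LHS]/((abs_op ip A \o abs_op ip A) v) PP.
by rewrite reC -(adjoint_pair_re adA).
Qed.

Hypothesis onE : orthonormal_basis ip (onb ip).
Local Notation hs := (hs (onb ip)).
Local Notation sums := (sums (onb ip)).

(* [A = W^* Q Q], where [Q^2 = |A|]. *)
Lemma trace_class_factor (A : Hs -> Hs) : bounded_op A ->
  exists Q W : Hs -> Hs, [/\ positive_op ip Q, linear W /\ (forall u, nr (W u) <= nr u),
    forall v u, ip (A v) u = ip (Q v) (Q (W u)) & hs Q = trace_norm ip A].
Proof.
move=> bA; have [pP nP] := abs_op_spec bA.
have [Q [pQ QQ]] := positive_sqrt hip pP.
have QE v : abs_op ip A v = Q (Q v) by rewrite -QQ.
have [[lA _] [[lP _] _]] := (bA, pP).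
have AP v : nr (A v) <= 1 * nr (abs_op ip A v) by rewrite mul1r nP.
have [W [lW W1 AW]] := douglas hip lA lP ler01 AP.
exists Q, W; split=> //.
- by split=> // u; have := W1 u; rewrite mul1r.
- by move=> v u; rewrite AW QE (positive_symmetric pQ).
- apply: eq_esum => e _; rewrite -/(re _ _) QE.
  by rewrite (adjoint_pair_re (positive_symmetric pQ)) re_vv.
Qed.

Lemma trace_norm_ge0 (A : Hs -> Hs) : bounded_op A -> (0 <= trace_norm ip A)%E.
Proof. by move=> /trace_class_factor[Q [W [_ _ _ <-]]]; exact: hs_ge0. Qed.

Lemma hs_comp_le (K Q : Hs -> Hs) (M t : R) : (forall v, nr (K v) <= M * nr v) ->
  0 <= M -> hs Q = t%:E -> (hs (K \o Q) <= (M ^+ 2 * t)%:E)%E.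
Proof. by move=> hK M0; apply: hs_le => // v; exact: hK. Qed.

Lemma hs_comp_fin (K Q : Hs -> Hs) (t : R) : bounded_op K ->
  hs Q = t%:E -> exists s : R, hs (K \o Q) = s%:E.
Proof.
move=> /bounded_opP[_ [M M0 hK]] hQ; apply: hs_fin.
by apply: (le_lt_trans (hs_comp_le hK M0 hQ)); exact: ltry.
Qed.

(** With [A = V Q Q], two operators at a time are commuted as Hilbert-Schmidt operators: both sums
    turn into the sum of [ip (K1 (V (Q e))) (L2 (Q e))], the trace of [Q K2 K1 V Q]. *)
Lemma trace_class_cycle (A K1 K2 : Hs -> Hs) :
  trace_class ip A -> bounded_op K1 -> bounded_op K2 ->
  exists l, sums (fun e => ip (K1 (A (K2 e))) e) l /\
            sums (fun e => ip (A (K2 (K1 e))) e) l.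
Proof.
move=> [bA tA] b1 b2; have [Q [W [pQ [lW W1] AQ hQ]]] := trace_class_factor bA.
have [t ht] : exists t : R, hs Q = t%:E by apply: hs_fin; rewrite hQ.
have sQ := positive_symmetric pQ.
have bW : bounded_op W by apply/bounded_opP; split=> //; exists 1 => // v; rewrite mul1r.
have [bV adW] := adjoint_spec hip bW; set V := adjoint ip W in bV adW.
have [b1' ad1] := adjoint_spec hip b1; set L1 := adjoint ip K1 in b1' ad1.
have [b2' ad2] := adjoint_spec hip b2; set L2 := adjoint ip K2 in b2' ad2.
have adV := adjoint_pairC adW.
have [s1 hs1] := hs_comp_fin b2' ht.
have [s2 hs2] := hs_comp_fin (bounded_comp b1 bV) ht.
have [s3 hs3] := hs_comp_fin (bounded_comp b1' b2') ht.
have [s4 hs4] := hs_comp_fin bV ht.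
have X1 : adjoint_pair ip (Q \o K2) (L2 \o Q) by move=> u v /=; rewrite sQ ad2.
have Y1 : adjoint_pair ip (Q \o (W \o L1)) ((K1 \o V) \o Q).
  by move=> u v /=; rewrite sQ adW (adjoint_pairC ad1).
have X2 : adjoint_pair ip (Q \o (K2 \o K1)) ((L1 \o L2) \o Q).
  by move=> u v /=; rewrite sQ ad2 ad1.
have Y2 : adjoint_pair ip (Q \o W) (V \o Q) by move=> u v /=; rewrite sQ adW.
have [l [l1 l2]] := hs_trace_comm hip onE X1 Y1
  (etrans (hs_adjoint hip onE X1) hs1) (etrans (hs_adjoint hip onE Y1) hs2).
have [k [k1 k2]] := hs_trace_comm hip onE X2 Y2
  (etrans (hs_adjoint hip onE X2) hs3) (etrans (hs_adjoint hip onE Y2) hs4).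
have lk : l = k.
  apply: sums_unique l2 _; apply: sums_ext k2 => e _ /=.
  by rewrite -(ad1 (V (Q e))).
exists l; split.
  by apply: sums_ext l1 => e _ /=; rewrite -AQ ad1.
by rewrite lk; apply: sums_ext k1 => e _ /=; rewrite -AQ.
Qed.

(* The usual constant is [M]; this one only takes [2 a b <= a^2 + b^2] instead of
   the Cauchy-Schwarz inequality for the Hilbert-Schmidt norm. *)
Lemma trace_bound (A K : Hs -> Hs) (M t : R) (l : Cx R) :
  bounded_op A -> trace_norm ip A = t%:E -> bounded_op K ->
  0 <= M -> (forall v, nr (K v) <= M * nr v) ->
  sums (fun e => ip (A (K e)) e) l -> modulus l <= (M ^+ 2 + 1) * t.
Proof.
move=> bA tA bK M0 hK hl.
have [Q [W [pQ [lW W1] AQ hQ]]] := trace_class_factor bA.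
have sQ := positive_symmetric pQ; rewrite tA in hQ.
have bW : bounded_op W by apply/bounded_opP; split=> //; exists 1 => // v; rewrite mul1r.
have [bV adW] := adjoint_spec hip bW.
have [bL adK] := adjoint_spec hip bK.
have hV v : nr (adjoint ip W v) <= 1 * nr v.
  by apply: (adjoint_pair_bound hip adW) => u; rewrite mul1r.
have hL := adjoint_pair_bound hip adK hK.
have X1 : adjoint_pair ip (Q \o K) (adjoint ip K \o Q).
  by move=> u v /=; rewrite sQ adK.
have Y1 : adjoint_pair ip (Q \o W) (adjoint ip W \o Q).
  by move=> u v /=; rewrite sQ adW.
have h1 := hs_comp_le hL M0 hQ; have h2 := hs_comp_le hV ler01 hQ.
(* To the right of [Q], [K] cannot be estimated term by term; the adjoint moves it to the left,
   where its bound applies. *)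
rewrite -(hs_adjoint hip onE X1) in h1; rewrite -(hs_adjoint hip onE Y1) in h2.
apply: (sums_le hl) => F FE.
have g1 := le_trans (le_fset_esum (fun e => nr ((Q \o K) e) ^+ 2) FE) h1.
have g2 := le_trans (le_fset_esum (fun e => nr ((Q \o W) e) ^+ 2) FE) h2.
rewrite lee_fin in g1; rewrite lee_fin in g2.
apply: (@le_trans _ _ (\sum_(e <- F) (nr ((Q \o K) e) ^+ 2 + nr ((Q \o W) e) ^+ 2))).
  elim/big_rec2 : _ => [|e x y _ hxy]; first by rewrite /modulus normr0.
  apply: (le_trans (modulusD _ _)); rewrite lerD// AQ.
  apply: (le_trans (modulus_ip_le _ _)) => /=.
  have := sqr_ge0 (nr (Q (K e)) - nr (Q (W e))).
  move: (nr _) (nr _) => a b; nra.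
rewrite big_split /=; move: g1 g2 => /=; lra.
Qed.

End TraceClass.

Lemma trace_sums (R : realType) (Hs : completeNormedModType (Cx R))
    (ip : {dot Hs for Num.conj}) (A : Hs -> Hs) l :
  sums (onb ip) (fun e => ip (A e) e) l -> trace ip A = l.
Proof. by move=> h; apply: (cvg_lim _ h); exact: norm_hausdorff. Qed.

(** [onb] then takes its default value, the empty set, and the trace is an empty sum. *)
Lemma trace_no_basis (R : realType) (Hs : completeNormedModType (Cx R))
    (ip : {dot Hs for Num.conj}) (A : Hs -> Hs) :
  ~ orthonormal_basis ip (onb ip) -> trace ip A = 0.
Proof.
move=> h; apply: trace_sums; apply: sums_ext (sums0 _) => e.
by move: h; rewrite /onb; case: xgetP => // E _ onE /(_ onE).
Qed.

(** * Suprema in the nonnegative extended reals *)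

Section Nnsup.
Variable R : realType.
Local Open Scope ereal_scope.

Lemma nnsup_ge0 (Y : set (\bar R)) : 0 <= nnsup Y.
Proof. by apply: ereal_sup_ubound; left. Qed.

Lemma nnsup_ub (Y : set (\bar R)) y : Y y -> y <= nnsup Y.
Proof. by move=> Yy; apply: ereal_sup_ubound; right. Qed.

Lemma nnsup_le (Y : set (\bar R)) b : 0 <= b -> (forall y, Y y -> y <= b) ->
  nnsup Y <= b.
Proof. by move=> b0 h; apply: ge_ereal_sup => y [->|/h]. Qed.

End Nnsup.

(** * Vanishing at infinity as a filter *)

Section Cocompact.
Variable Xi : topologicalZmodType.

(** As a filter, decay conditions can be intersected finitely and fed to the covering form of
    compactness. For compact [Xi] it contains the empty set, hence only a [Filter]. *)
Definition cocompact : set_system Xi := filter_from (@compact Xi) (fun K => ~` K).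

#[local] Instance cocompact_filter : Filter cocompact.
Proof.
apply: filter_from_filter; first by exists set0; exact: compact0.
move=> K L cK cL; exists (K `|` L); first exact: compactU.
by rewrite setCU.
Qed.

Lemma cocompact_shift (y : Xi) (Q : Xi -> Prop) :
  (\forall x \near cocompact, Q x) -> \forall x \near cocompact, Q (x - y).
Proof.
move=> [K cK KQ]; exists [set x + y | x in K].
  apply: continuous_compact => //; apply: continuous_subspaceT => x.
  apply: (@continuous2_cvg _ _ _ _ _ _ _ _ (fun a b : Xi => a + b)) => //.
  - exact: (@add_continuous Xi (x, y)).
  - exact: cvg_cst.
move=> x /= nKx; apply: KQ => Kxy; apply: nKx; exists (x - y) => //.
by rewrite subrK.
Qed.

Lemma vanishes_cocompact (R : realType) (F : Xi -> \bar R) :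
  vanishes_at_infinity F <->
  forall eps, 0 < eps -> \forall x \near cocompact, (`|F x| < eps%:E)%E.
Proof.
split=> h eps e0; have := h eps e0; first by move=> [K cK KF]; exists K.
by move=> [K cK KF]; exists K.
Qed.

End Cocompact.
Arguments cocompact Xi : clear implicits.
#[local] Existing Instance cocompact_filter.

(** * Convolution: translation, Lipschitz bound, decay on the span *)

Section Convolution.
Variables (R : realType) (Xi : topologicalZmodType) (m : Xi -> Xi -> Cx R).
Variables (Hs : completeNormedModType (Cx R)) (ip : {dot Hs for Num.conj}).
Variables (U : Xi -> Hs -> Hs) (P : Hs -> Hs).
Hypothesis hip : hilbert_form ip.
Hypothesis m1 : forall x y, `|m x y| = 1.
Hypothesis repU : projective_rep m ip U.
Hypothesis uP : unitary_op ip P.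

Lemma unitary_nr (V : Hs -> Hs) v : unitary_op ip V -> nr (V v) = nr v.
Proof.
move=> [bV _ V2]; have [_ adV] := adjoint_spec hip bV.
apply/eqP; rewrite -(@eqrXn2 _ 2) ?nr_ge0// -!(re_vv hip) (adjoint_pair_re adV).
by rewrite -[adjoint ip V (V v)]/((adjoint ip V \o V) v) V2.
Qed.

Lemma unitary_adj_nr (V : Hs -> Hs) v : unitary_op ip V -> nr (adjoint ip V v) = nr v.
Proof.
move=> uV; rewrite -(unitary_nr _ uV); case: uV => _ V1 _.
by rewrite -[V (adjoint ip V v)]/((V \o adjoint ip V) v) V1.
Qed.

Lemma alpha_beta_bounded (B : Hs -> Hs) x : bounded_op B ->
  bounded_op (alpha ip U x (beta_minus P B)).
Proof.
move=> bB; have [/(_ x)[bU _ _] _ _] := repU; have [bP _ _] := uP.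
have [bU' _] := adjoint_spec hip bU.
have bPBP := bounded_comp (bounded_comp bP bB) bP.
exact: bounded_comp (bounded_comp bU bPBP) bU'.
Qed.

Lemma alpha_beta_nr (B : Hs -> Hs) x (M : R) : (forall v, nr (B v) <= M * nr v) ->
  forall v, nr (alpha ip U x (beta_minus P B) v) <= M * nr v.
Proof.
move=> hB v; have [/(_ x) uU _ _] := repU; rewrite /alpha /beta_minus /=.
rewrite (unitary_nr _ uU) (unitary_nr _ uP).
by apply: (le_trans (hB _)); rewrite (unitary_nr _ uP) (unitary_adj_nr _ uU).
Qed.

(** [U x] is [U y \o U (x - y)] up to the phase [c^-1]; the phases [c] and [c^-1] arising on the two
    sides of [D] cancel. *)
Lemma alpha_shift (D : Hs -> Hs) x y v : linear D ->
  adjoint ip (U y) (alpha ip U x D (U y v)) = alpha ip U (x - y) D v.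
Proof.
move=> lD; have [uU UU _] := repU; rewrite /alpha /=.
set z := x - y; set c := m y z.
have yz : y + z = x by rewrite /z addrC subrK.
have c0 : c != 0 by rewrite -normr_eq0 m1 oner_eq0.
have KU a w : adjoint ip (U a) (U a w) = w.
  by have [_ _ h] := uU a; rewrite -[LHS]/((adjoint ip (U a) \o U a) w) h.
have UK a w : U a (adjoint ip (U a) w) = w.
  by have [_ h _] := uU a; rewrite -[LHS]/((U a \o adjoint ip (U a)) w) h.
have lU a : linear (U a) by case: (uU a) => -[].
have lU' a : linear (adjoint ip (U a)).
  by have [bU _ _] := uU a; have [[]] := adjoint_spec hip bU.
have Ux w : U x w = c^-1 *: U y (U z w).
  by rewrite UU yz scalerA mulVf// scale1r.
have -> : adjoint ip (U x) (U y v) = c *: adjoint ip (U z) v.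
  by rewrite -{1}(UK z v) UU yz (linopZ (lU' x)) KU.
rewrite Ux (linopZ (lU' y)) KU (linopZ lD) (linopZ (lU z)) scalerA.
by rewrite mulVf// scale1r.
Qed.

Hypothesis onE : orthonormal_basis ip (onb ip).

Lemma op_conv_sums (A : trace_class_op ip) (B : Hs -> Hs) x : bounded_op B ->
  sums (onb ip) (fun e => ip (A (alpha ip U x (beta_minus P B) e)) e)
    (op_conv ip U P A B x).
Proof.
move=> bB; have bC := alpha_beta_bounded x bB.
(* Taking [K1 = id] extracts mere convergence from the cyclicity lemma. *)
have [l [h _]] := trace_class_cycle hip onE (tc_opP A) (bounded_id Hs) bC.
by rewrite /op_conv (trace_sums h).
Qed.

Lemma op_conv_translate_sums (A : trace_class_op ip) (B : Hs -> Hs) x y :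
  bounded_op B ->
  sums (onb ip)
    (fun e => ip (alpha ip U y A (alpha ip U x (beta_minus P B) e)) e)
    (op_conv ip U P A B (x - y)).
Proof.
move=> bB; have bC := alpha_beta_bounded x bB.
have [/(_ y)[bU _ _] _ _] := repU; have [bU' _] := adjoint_spec hip bU.
(* Cycling [U y] around leaves [A] composed with the conjugate by [U y] of the translated operator,
   which [alpha_shift] turns into the translate by [x - y]. *)
have [l [h1 h2]] := trace_class_cycle hip onE (tc_opP A) bU (bounded_comp bU' bC).
rewrite /op_conv (@trace_sums _ _ _ _ l)//; apply: sums_ext h2 => e _ /=.
rewrite alpha_shift//; have [[lP _] _ _] := uP; have [lB _] := bB.
by move=> a u v; rewrite /beta_minus /= lP lB lP.
Qed.

Lemma op_conv_close (A T : trace_class_op ip) (B : Hs -> Hs) x (M d : R) :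
  bounded_op B -> 0 <= M -> (forall v, nr (B v) <= M * nr v) ->
  trace_norm_ball A d T ->
  modulus (op_conv ip U P A B x - op_conv ip U P T B x) <= (M ^+ 2 + 1) * d.
Proof.
move=> bB M0 hB; rewrite /trace_norm_ball /=; set D := fun v => A v - T v => tD.
have [bA _] := tc_opP A; have [bT _] := tc_opP T.
have bD : bounded_op D.
  move: bA bT => /bounded_opP[lA [a a0 hA]] /bounded_opP[lT [t t0 hT]].
  apply/bounded_opP; split.
    by move=> c u v; rewrite /D lA lT opprD addrACA scalerBr.
  exists (a + t) => [|v]; first exact: addr_ge0.
  by rewrite mulrDl; apply: (le_trans (nrD _ _)); rewrite nrN lerD.
have [t ht] : exists t : R, trace_norm ip D = t%:E.
  exists (fine (trace_norm ip D)); rewrite fineK// ge0_fin_numE.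
    by apply: lt_trans tD _; exact: ltry.
  exact: trace_norm_ge0.
have h : sums (onb ip) (fun e => ip (D (alpha ip U x (beta_minus P B) e)) e)
    (op_conv ip U P A B x - op_conv ip U P T B x).
  have hAT := sumsB (op_conv_sums (A := A) (x := x) bB)
                    (op_conv_sums (A := T) (x := x) bB).
  apply: (sums_ext _ hAT) => e _.
  by rewrite linearBl.
have := trace_bound hip onE bD ht (alpha_beta_bounded x bB) M0 (alpha_beta_nr x hB) h.
move/le_trans; apply; apply: ler_wpM2l; first by rewrite addr_ge0// sqr_ge0.
by move: tD; rewrite ht lte_fin => /ltW.
Qed.

Lemma translate_span_near (S : set (trace_class_op ip)) (X : set (Hs -> Hs))
    (T : trace_class_op ip) (d : R) :
  X `<=` @bounded_op R Hs -> 0 < d ->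
  (forall A, S A -> forall eps, 0 < eps -> \forall x \near cocompact Xi,
     forall B, X B -> modulus (op_conv ip U P A B x) <= eps) ->
  translate_span U S T ->
  \forall x \near cocompact Xi, forall B, X B -> modulus (op_conv ip U P T B x) <= d.
Proof.
move=> bX d0 hS [n [c [A [y [SA Tv]]]]].
(* An equal share of [d] for each term; [n.+1] and [1 + modulus (c i)] keep the denominator positive
   for an empty sum or a zero coefficient. *)
pose eps i : R := d / (n.+1%:R * (1 + modulus (c i))).
have eps0 i : 0 < eps i.
  by rewrite divr_gt0// mulr_gt0// ltr_pwDl// modulus_ge0.
have : \forall x \near cocompact Xi, forall i, forall B, X B ->
    modulus (op_conv ip U P (A i) B (x - y i)) <= eps i.
  apply: filter_forall => i.
  exact: (cocompact_shift (y i) (hS _ (SA i) _ (eps0 i))).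
apply: filterS => x hx B XB; have bB := bX _ XB.
have h : sums (onb ip) (fun e => ip (T (alpha ip U x (beta_minus P B) e)) e)
    (\sum_(i < n) c i * op_conv ip U P (A i) B (x - y i)).
  apply: sums_ext (sums_sum (fun i => sumsZ (c := c i)
    (op_conv_translate_sums (A := A i) (x := x) (y := y i) bB))) => e _.
  by rewrite Tv linear_sumlz; apply: eq_bigr => i _; rewrite linearZl_LR.
rewrite (sums_unique (op_conv_sums (A := T) (x := x) bB) h).
apply: (@le_trans _ _ (\sum_(i < n) (d / n.+1%:R))); last first.
  rewrite sumr_const card_ord -[leLHS]mulr_natr mulrAC ler_pdivrMr ?ltr0n//.
  by rewrite ler_pM2l// ler_nat.
elim/big_rec2 : _ => [|i a b _ hab]; first by rewrite /modulus normr0.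
apply: (le_trans (modulusD _ _)); rewrite lerD// modulusM.
have mc : 0 < 1 + modulus (c i) by rewrite ltr_pwDl// modulus_ge0.
apply: (@le_trans _ _ ((1 + modulus (c i)) * eps i)).
  apply: ler_pM; rewrite ?modulus_ge0 ?lerDr//; exact: hx.
by rewrite /eps invfM (mulrA d) mulrC mulfVK// gt_eqF.
Qed.

End Convolution.

(** * Balls of the trace norm *)

Section TraceNormTopology.
Variables (R : realType) (Hs : completeNormedModType (Cx R)).
Variable ip : {dot Hs for Num.conj}.
Hypothesis hip : hilbert_form ip.

Lemma trace_norm_ball_open (A : trace_class_op ip) (d : R) : 0 < d ->
  open (trace_norm_ball A d).
Proof.
move=> d0; exists [set trace_norm_ball A d]; last by rewrite bigcup_set1.
move=> _ ->; exists [fset (trace_norm_ball A d : set (trace_class_op ip))]%fset.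
  by move=> O; rewrite in_fset1 => /eqP ->; apply/mem_set; exists A, d.
by rewrite set_fset1 bigcap_set1.
Qed.

(** The chosen absolute value of the zero operator vanishes because it has the same norms. *)
Lemma trace_norm_ball_center (A : trace_class_op ip) (d : R) : 0 < d ->
  trace_norm_ball A d A.
Proof.
move=> d0; rewrite /trace_norm_ball /=.
rewrite (_ : (fun v => A v - A v) = (fun=> 0)); last by apply/funext => v; rewrite subrr.
have b0 : bounded_op (fun _ : Hs => 0 : Hs).
  apply/bounded_opP; split; first by move=> a u v; rewrite scaler0 addr0.
  by exists 0 => // v; rewrite nr0 mul0r.
rewrite /trace_norm esum1 ?lte_fin// => e _.
have [_ h] := abs_op_spec hip b0.
by rewrite (nr_eq0 (etrans (h e) (nr0 _))) linear0l.
Qed.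

End TraceNormTopology.

(** * From locally uniform to uniform decay *)

Theorem theorem4p7 (R : realType)
  (Xi : topologicalZmodType) (mu : {measure set (borel Xi) -> \bar R})
  (m : Xi -> Xi -> Cx R)
  (Hs : completeNormedModType (Cx R)) (ip : {dot Hs for Num.conj})
  (U : Xi -> Hs -> Hs) (P : Hs -> Hs)
  (S H : set (trace_class_op ip)) (X : set (Hs -> Hs)) :
  lc_abelian_group Xi ->
  haar_measure mu ->
  phase_space m ->
  hilbert_form ip ->
  projective_rep m ip U ->
  irreducible_rep U ->
  integrable_rep mu ip U ->
  parity_op ip U P ->
  regular U S ->
  compact (closure H) ->
  bounded_subset X ->
  (forall A0 : trace_class_op ip, S A0 ->
     vanishes_at_infinity (fun x : Xi =>
       nnsup [set (modulus (op_conv ip U P A0 B x))%:E | B in X])) ->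
  vanishes_at_infinity (fun x : Xi =>
    nnsup [set nnsup [set (modulus (op_conv ip U P A B x))%:E | B in X]
          | A in H]).
Proof.
move=> _ _ [m1 _ _ _ _] hip repU _ _ [uP _ _] regS cH [bX [M0 hM0]] hS.
apply/vanishes_cocompact => eps e0.
(* A non-strict bound by [eps / 2] survives both suprema and stays strictly below [eps]. *)
suff h : \forall x \near cocompact Xi, forall A, closure H A ->
    forall B, X B -> modulus (op_conv ip U P A B x) <= eps / 2.
  apply: filterS h => x hx; rewrite gee0_abs; last exact: nnsup_ge0.
  apply: (@le_lt_trans _ _ (eps / 2)%:E); last by rewrite lte_fin; lra.
  apply: nnsup_le; first by rewrite lee_fin; lra.
  move=> _ [A HA <-]; apply: nnsup_le; first by rewrite lee_fin; lra.
  move=> _ [B XB <-]; rewrite lee_fin; apply: hx => //; exact: subset_closure.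
have [onE|nE] := pselect (orthonormal_basis ip (onb ip)); last first.
  apply: filterE => x A _ B _; rewrite /op_conv trace_no_basis//.
  by rewrite /modulus normr0 /=; lra.
pose M := modulus M0; have M_ge0 : 0 <= M by exact: modulus_ge0.
have hB B v : X B -> nr (B v) <= M * nr v.
  by move=> XB; apply: bounded_bound => w; exact: hM0.
pose c := M ^+ 2 + 1; have c0 : 0 < c by rewrite ltr_wpDl// sqr_ge0.
(* Two Lipschitz steps of cost [c * d = eps / 8] and the decay [eps / 4] of a span element add up to
   [eps / 2]. *)
pose d := eps / (8 * c); have d0 : 0 < d by rewrite divr_gt0// mulr_gt0.
have cd : c * d = eps / 8 by rewrite /d invfM mulrCA [c * _]mulrC mulfVK ?gt_eqF.
have {}hS A0 : S A0 -> forall e, 0 < e -> \forall x \near cocompact Xi,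
    forall B, X B -> modulus (op_conv ip U P A0 B x) <= e.
  move=> SA0 e ep; have /vanishes_cocompact/(_ e ep) := hS _ SA0.
  apply: filterS => x; rewrite gee0_abs; last exact: nnsup_ge0.
  move=> he B XB; rewrite -lee_fin; apply: ltW; apply: le_lt_trans he.
  by apply: nnsup_ub; exists B.
(* Compactness of [closure H] exchanges the quantifiers: decay uniform near each [A] becomes uniform
   on the whole set. *)
apply: ((compact_near_coveringP _).1 cH _ _
  (fun x A => forall B, X B -> modulus (op_conv ip U P A B x) <= eps / 2)).
move=> A _.
have bA : nbhs A (trace_norm_ball A d).
  apply: open_nbhs_nbhs; split; [exact: trace_norm_ball_open|].
  exact: trace_norm_ball_center.
have [|T [AT spT]] := regS _ _ (trace_norm_ball_open A d0).
  by exists A; exact: trace_norm_ball_center.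
have e4 : 0 < eps / 4 by lra.
have hT := translate_span_near hip m1 repU uP onE bX e4 hS spT.
exists (trace_norm_ball A d,
    [set x | forall B, X B -> modulus (op_conv ip U P T B x) <= eps / 4]).
  by split; [exact: bA | exact: hT].
move=> [A' x] /= [AA' Tx] B XB.
(* [T] and [A'] are both compared with the centre [A], and the triangle inequality is applied to the
   values of the convolutions. *)
have h1 := op_conv_close hip repU uP onE x (bX _ XB) M_ge0 (fun v => hB B v XB) AT.
have h2 := op_conv_close hip repU uP onE x (bX _ XB) M_ge0 (fun v => hB B v XB) AA'.
have h3 := Tx B XB; rewrite -/c cd in h1 h2.
move: h1 h2 h3.
set a := op_conv ip U P A B x; set a' := op_conv ip U P A' B x.
set t := op_conv ip U P T B x => h1 h2 h3.
have -> : a' = - (a - a') + ((a - t) + t) by rewrite subrK opprB subrK.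
have := modulusD (- (a - a')) ((a - t) + t); have := modulusD (a - t) t.
rewrite modulusN; lra.
Qed.
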